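(* Assume that $Z$ has a finite second moment and that: (i) (linearity condition) $Q_c\,\mathbb{E}[Z|P_cZ]=0$ a.s.; (ii) (diagonal conditional variance) there is a real random variable $\lambda^{\ast}_{\omega}$ such that $\operatorname{var}(Z|P_cZ)=\lambda^{\ast}_{\omega}Q_c$ a.s.; (iii) for every $\eta\in E_c$ with $\|\eta\|=1$, $$\mathbb{P}\left(\mathbb{E}\left[(\eta^TZ)^2|Y\right]=\mathbb{E}\left[\left.\tfrac{\|Q_cZ\|^2}{p-d}\right|Y\right]\right)<1.$$ If $\Psi$ is a total countable family in the space $L_1\big(\mathbb{E}[\|Z\|^2\,|Y=y]\,P_Y(dy)\big)$, then there exists a finite linear combination $\psi$ of functions in $\Psi$ such that $$E_{\psi}=E_c.$$
   Context: $Y$ is a real random variable, $X$ a random vector in $\mathbb{R}^p$ with invertible covariance matrix $\Sigma$, and $Z=\Sigma^{-1/2}(X-\mathbb{E}[X])$, so $\mathbb{E}[Z]=0$ and $\operatorname{var}(Z)=I$. A dimension reduction subspace (DRS) for $Z$ is a linear subspace $E\subset\mathbb{R}^p$ such that $Y$ and $Z$ are conditionally independent given $PZ$, $P$ being the orthogonal projection on $E$. The (standardized) central subspace $E_c$ is the unique DRS of minimal dimension, equal to the intersection of all DRS. Standing assumption: $X$ has a density whose support has a boundary of Lebesgue measure $0$, and $E_c$ exists. $P_c$ is the orthogonal projection on $E_c$, $Q_c=I-P_c$, $d=\dim E_c<p$. $P_Y$ is the law of $Y$. For $\theta:\mathbb{R}\to\mathbb{R}_+$ and a measure $\mu$ on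 $\mathbb{R}$, $L_1(\theta(y)\mu(dy))$ is the space of functions $u:\mathbb{R}\to\mathbb{R}$ with $\int|u(y)|\theta(y)\mu(dy)<\infty$. A family is total if its linear span is dense. For a measurable $\psi$ with $ZZ^T\psi(Y)$ integrable, $M_\psi=\mathbb{E}[ZZ^T\psi(Y)]$, $\lambda^{\ast}_\psi=\frac{1}{p-d}\mathbb{E}[\|Q_cZ\|^2\psi(Y)]$, and the $\psi$-space is $E_\psi=\operatorname{span}(M_\psi-\lambda_\psi^{\ast}I)$ (the column space), i.e. the orthogonal complement of $\{\eta: M_\psi\eta=\lambda^{\ast}_\psi\eta\}$. *)

(* Defs.v *)
From HB Require Import structures.
From mathcomp Require Import all_boot all_order all_algebra.
From mathcomp Require Import all_classical all_reals all_analysis.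

Set Implicit Arguments.
Unset Strict Implicit.
Unset Printing Implicit Defensive.

Import Order.TTheory GRing.Theory Num.Theory.
Import numFieldNormedType.Exports.

Local Open Scope classical_set_scope.
Local Open Scope ring_scope.

(* Product sigma-algebra on matrices; on 'cV[R]_n it is the Borel one. *)

Definition matrix_display : measure_display -> measure_display.
Proof. exact. Qed.

Section measurable_matrix.
Context {d : measure_display} {T : measurableType d} (m n : nat).

Definition mx_measurable : set (set 'M[T]_(m, n)) :=
  <<s [set A | exists i j, exists2 B, measurable B
                 & A = (fun M : 'M[T]_(m, n) => M i j) @^-1` B] >>.

Let mx_measurable0 : mx_measurable set0.
Proof. exact: sigma_algebra0. Qed.

Let mx_measurableC A : mx_measurable A -> mx_measurable (~` A).
Proof. exact: sigma_algebraC. Qed.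

Let mx_measurable_bigcup (F : (set _)^nat) :
  (forall i, mx_measurable (F i)) -> mx_measurable (\bigcup_i (F i)).
Proof. exact: sigma_algebra_bigcup. Qed.

HB.instance Definition _ := @isMeasurable.Build (matrix_display d)
  'M[T]_(m, n) mx_measurable mx_measurable0 mx_measurableC mx_measurable_bigcup.

Lemma measurable_mx_entry (i : 'I_m) (j : 'I_n) :
  measurable_fun setT (fun M : 'M[T]_(m, n) => M i j).
Proof.
move=> _ B mB; rewrite setTI; apply: sub_sigma_algebra.
by exists i, j; exists B.
Qed.

Lemma measurable_fun_mxP d' (S : measurableType d') (f : S -> 'M[T]_(m, n)) :
  measurable_fun setT f <->
  forall i j, measurable_fun setT (fun x => f x i j).
Proof.
split=> [mf i j|mf].
  exact: (measurableT_comp (measurable_mx_entry i j) mf).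
apply: measurability; first exact: erefl.
move=> A [B [i [j [C mC ->]]] <-].
exact: mf.
Qed.

End measurable_matrix.

(* Lebesgue measure on R^n, by R^(n+1) = R * R^n. *)

Section lebesgue_cons.
Context {R : realType} {n : nat} (mu : {sigma_finite_measure set 'cV[R]_n -> \bar R}).

Definition cV_cons (z : R * 'cV[R]_n) : 'cV[R]_n.+1 :=
  col_mx (const_mx z.1 : 'cV[R]_1) z.2.

Lemma measurable_cV_cons : measurable_fun setT cV_cons.
Proof.
apply/measurable_fun_mxP => i j; rewrite ord1 /cV_cons.
rewrite -[i](@splitK 1 n); case: (@fintype.split 1 n i) => k /=.
  by under eq_fun do rewrite (@col_mxEu _ 1 n 1) mxE; exact: measurable_fst.
under eq_fun do rewrite (@col_mxEd _ 1 n 1).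
exact: (measurableT_comp (measurable_mx_entry k ord0) measurable_snd).
Qed.

Definition lebesgue_cons : set 'cV[R]_n.+1 -> \bar R :=
  pushforward (@lebesgue_measure R \x mu)%E cV_cons.

Let lebesgue_cons0 : lebesgue_cons set0 = 0%E.
Proof. by rewrite /lebesgue_cons /pushforward preimage_set0 measure0. Qed.

Let lebesgue_cons_ge0 A : (0 <= lebesgue_cons A)%E.
Proof. by rewrite /lebesgue_cons /pushforward measure_ge0. Qed.

Let lebesgue_cons_sigma_additive : semi_sigma_additive lebesgue_cons.
Proof.
have mE A : measurable A -> measurable (cV_cons @^-1` A).
  by move=> mA; rewrite -[X in measurable X]setTI; exact: measurable_cV_cons.
move=> F mF tF mUF; rewrite /lebesgue_cons /pushforward preimage_bigcup.
apply: measure_semi_sigma_additive.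
- by move=> k; exact: mE.
- apply/trivIsetP => /= i j _ _ ij; rewrite -preimage_setI.
  by move/trivIsetP : tF => /(_ _ _ _ _ ij) ->//; rewrite preimage_set0.
- by rewrite -preimage_bigcup; exact: mE.
Qed.

HB.instance Definition _ := isMeasure.Build _ _ _ lebesgue_cons
  lebesgue_cons0 lebesgue_cons_ge0 lebesgue_cons_sigma_additive.

Let lebesgue_cons_sigma_finite : sigma_finite setT lebesgue_cons.
Proof.
have /sigma_finiteP[F [TF ndF Foo]] := sigma_finiteT (@lebesgue_measure R).
have /sigma_finiteP[G [TG ndG Goo]] := sigma_finiteT mu.
pose g (v : 'cV[R]_n.+1) : R * 'cV[R]_n := (v ord0 ord0, @dsubmx _ 1 n 1 v).
have mg : measurable_fun setT g.
  apply/measurable_fun_pairP; split; first exact: measurable_mx_entry.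
  apply/measurable_fun_mxP => i j; under eq_fun do rewrite !mxE.
  exact: measurable_mx_entry.
have gK : g \o cV_cons = id.
  apply/funext => -[x v] /=; rewrite /g /cV_cons /= col_mxKd; congr pair.
  rewrite (_ : ord0 = lshift n (ord0 : 'I_1)); last exact/val_inj.
  by rewrite (@col_mxEu _ 1 n 1) mxE.
exists (fun k => g @^-1` (F k `*` G k)).
  rewrite -preimage_bigcup (_ : \bigcup_k _ = setT) ?preimage_setT//.
  rewrite -setXTT TF TG predeqE => -[x y]; split.
    by move=> [k _ []/= ? ?]; split; exists k.
  move=> [/= [k _ Fkx] [l _ Gly]]; exists (maxn k l) => //; split.
  - by move: x Fkx; exact/subsetPset/ndF/leq_maxl.
  - by move: y Gly; exact/subsetPset/ndG/leq_maxr.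
move=> k; have [? ?] := Foo k; have [? ?] := Goo k; split.
  by rewrite -[X in measurable X]setTI; apply: mg => //; exact: measurableX.
rewrite /lebesgue_cons /pushforward -comp_preimage gK preimage_id.
by rewrite product_measure1E// lte_mul_pinfty// ge0_fin_numE.
Qed.

HB.instance Definition _ :=
  Measure_isSigmaFinite.Build _ _ _ lebesgue_cons lebesgue_cons_sigma_finite.

End lebesgue_cons.

Fixpoint lebesgue_Rn (R : realType) (n : nat) :
    {sigma_finite_measure set 'cV[R]_n -> \bar R} :=
  match n with
  | 0 => @dirac _ 'cV[R]_0 0 R
  | n'.+1 => lebesgue_cons (lebesgue_Rn R n')
  end.

(* Conditional expectations are selected among their versions; every use below
   is insensitive to the choice of a version.  When U is not integrable there
   is no version and the operators return the zero function. *)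

Section conditional_expectation.
Context {d : measure_display} {T : measurableType d} {R : realType}
  (P : probability T R).

Definition is_cexp (G : set (set T)) (U V : T -> R) : Prop :=
  [/\ forall B, measurable B -> G (V @^-1` B),
      P.-integrable setT (EFin \o V)
    & forall A, G A ->
        (\int[P]_(w in A) (V w)%:E = \int[P]_(w in A) (U w)%:E)%E].

Definition cexp (G : set (set T)) (U : T -> R) : T -> R :=
  xget (cst 0 : T -> R) [set V | is_cexp G U V].

Definition cprob (G : set (set T)) (A : set T) : T -> R :=
  cexp G (\1_A : T -> R).

Definition cond_indep (F H G : set (set T)) : Prop :=
  forall A B, F A -> H B ->
    {ae P, forall w, cprob G (A `&` B) w = cprob G A w * cprob G B w}.

Context {p : nat}.

Definition mean_cV (V : T -> 'cV[R]_p) : 'cV[R]_p :=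
  \col_i fine 'E_P[fun w => V w i ord0].

Definition covmx (V : T -> 'cV[R]_p) : 'M[R]_p :=
  \matrix_(i, j) fine (covariance P (fun w => V w i ord0) (fun w => V w j ord0)).

Definition cexp_cV (G : set (set T)) (V : T -> 'cV[R]_p) (w : T) : 'cV[R]_p :=
  \col_i cexp G (fun w' => V w' i ord0) w.

Definition cvar_cV (G : set (set T)) (V : T -> 'cV[R]_p) (w : T) : 'M[R]_p :=
  \matrix_(i, j) cexp G (fun w' => (V w' - cexp_cV G V w') i ord0
                                 * (V w' - cexp_cV G V w') j ord0) w.

(* [regression Y U] is the function y |-> E[U | Y = y]. *)

Definition is_regression (Y : {RV P >-> R}) (U : T -> R) (h : R -> R) : Prop :=
  [/\ measurable_fun setT h,
      (distribution P Y).-integrable setT (EFin \o h)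
    & forall B, measurable B ->
        (\int[distribution P Y]_(y in B) (h y)%:E
         = \int[P]_(w in Y @^-1` B) (U w)%:E)%E].

Definition regression (Y : {RV P >-> R}) (U : T -> R) : R -> R :=
  xget (cst 0 : R -> R) [set h | is_regression Y U h].

End conditional_expectation.

Section euclidean.
Context {R : realType} {p : nat}.

(* The library norm on matrices is the sup norm. *)
Definition enorm (v : 'cV[R]_p) : R := Num.sqrt (\sum_i v i ord0 ^+ 2).

Definition dotv (u v : 'cV[R]_p) : R := (u^T *m v) ord0 ord0.

(* the unique positive semidefinite square root of such a matrix *)
Definition sqrtmx (A : 'M[R]_p) : 'M[R]_p :=
  xget 0 [set S : 'M[R]_p |
    [/\ S^T = S, forall v : 'cV[R]_p, 0 <= dotv v (S *m v) & S *m S = A]].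

Definition orth_proj (E : {vspace 'cV[R]_p}) : 'M[R]_p :=
  xget 0 [set Q : 'M[R]_p | forall v : 'cV[R]_p,
    Q *m v \in E /\ forall u, u \in E -> dotv u (v - Q *m v) = 0].

Definition column_space (A : 'M[R]_p) : {vspace 'cV[R]_p} :=
  <<[seq col j A | j <- enum 'I_p]>>%VS.

End euclidean.

Section dimension_reduction.
Context {d : measure_display} {T : measurableType d} {R : realType}
  (P : probability T R) {p : nat}.

Definition standardized (X : T -> 'cV[R]_p) (w : T) : 'cV[R]_p :=
  sqrtmx (invmx (covmx P X)) *m (X w - mean_cV P X).

Definition is_DRS (Y : T -> R) (Z : T -> 'cV[R]_p) (E : {vspace 'cV[R]_p}) : Prop :=
  cond_indep P (g_sigma_algebra_preimage Y) (g_sigma_algebra_preimage Z)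
    (g_sigma_algebra_preimage (fun w => orth_proj E *m Z w)).

Definition is_central_subspace (Y : T -> R) (Z : T -> 'cV[R]_p)
    (E : {vspace 'cV[R]_p}) : Prop :=
  [/\ is_DRS Y Z E,
      forall F, is_DRS Y Z F -> F <> E -> (\dim E < \dim F)%N
    & forall v, v \in E <-> forall F, is_DRS Y Z F -> v \in F].

Definition is_density (X : {RV P >-> 'cV[R]_p}) (f : 'cV[R]_p -> R) : Prop :=
  [/\ measurable_fun setT f, forall x, 0 <= f x
    & forall B, measurable B ->
        distribution P X B = (\int[lebesgue_Rn R p]_(x in B) (f x)%:E)%E].

(* The support of a density is that of the law it defines: the closure of
   {f <> 0} would depend on the chosen version of the density. *)
Definition law_support (X : {RV P >-> 'cV[R]_p}) : set 'cV[R]_p :=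
  [set x | forall U : set 'cV[R]_p, open U -> U x -> (0 < distribution P X U)%E].

Definition boundary (A : set 'cV[R]_p) : set 'cV[R]_p :=
  closure A `\` interior A.

Definition psi_matrix (Y : T -> R) (Z : T -> 'cV[R]_p) (psi : R -> R) : 'M[R]_p :=
  \matrix_(i, j) fine 'E_P[fun w => (Z w *m (Z w)^T) i j * psi (Y w)].

Definition lambda_star (Y : T -> R) (Z : T -> 'cV[R]_p)
    (Ec : {vspace 'cV[R]_p}) (psi : R -> R) : R :=
  fine 'E_P[fun w => enorm ((1%:M - orth_proj Ec) *m Z w) ^+ 2 * psi (Y w)]
    / (p - \dim Ec)%:R.

Definition psi_space (Y : T -> R) (Z : T -> 'cV[R]_p)
    (Ec : {vspace 'cV[R]_p}) (psi : R -> R) : {vspace 'cV[R]_p} :=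
  column_space (psi_matrix Y Z psi - (lambda_star Y Z Ec psi)%:M).

End dimension_reduction.

Section weighted_L1.
Context {R : realType}.

Definition weighted_L1 (theta : R -> R) (mu : {measure set R -> \bar R}) :
    set (R -> R) :=
  [set u : R -> R | measurable_fun setT u /\
           (\int[mu]_y (`|u y| * theta y)%:E < +oo)%E].

Definition lin_span (Psi : set (R -> R)) : set (R -> R) :=
  [set v : R -> R | exists n (c : 'I_n -> R) (f : 'I_n -> R -> R),
     (forall i, Psi (f i)) /\ v = (fun y => \sum_i c i * f i y)].

Definition total_in_L1 (theta : R -> R) (mu : {measure set R -> \bar R})
    (Psi : set (R -> R)) : Prop :=
  Psi `<=` weighted_L1 theta mu /\
  forall u, weighted_L1 theta mu u -> forall e : R, 0 < e ->
    exists2 v, lin_span Psi v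
             & (\int[mu]_y (`|u y - v y| * theta y)%:E < e%:E)%E.

End weighted_L1.

(* Main.v *)
(* Write A_psi = M_psi - lambda*_psi I, with P and Q the projections on E_c and
   on its orthogonal complement.  Conditions (i) and (ii) say that, given PZ,
   the functions (a . PZ)(b . QZ) and (QZ)_i (QZ)_j - Q_ij |QZ|^2 / (p - d) of Z
   have conditional expectation 0.  By conditional independence they then have
   conditional expectation 0 given Y as well, whence P M_psi Q = 0 and
   Q M_psi Q = lambda*_psi Q, so the range of A_psi lies in E_c for every psi.

   For a unit vector eta of E_c, eta^T A_psi eta is the expectation of
   ((eta . Z)^2 - |QZ|^2 / (p - d)) psi(Y).  If it vanished for every psi in the
   span of the total family it would vanish, by density, for all indicators,
   contradicting (iii).  The matrices A_psi thus form a linear space of symmetric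
   matrices with no common isotropic vector in E_c, and one of maximal rank has
   range E_c: a kernel vector eta of it in E_c would satisfy eta^T B eta = 0 for
   every B of the space, since otherwise A + t B has larger rank for some t. *)

Require Import Defs.
From HB Require Import structures.
From mathcomp Require Import all_boot all_order all_algebra.
From mathcomp Require Import all_classical all_reals all_analysis.
From mathcomp Require Import measurable_realfun.

Set Implicit Arguments.
Unset Strict Implicit.
Unset Printing Implicit Defensive.

Import Order.TTheory GRing.Theory Num.Theory.
Import numFieldNormedType.Exports.

Local Open Scope classical_set_scope.
Local Open Scope ring_scope.

(** * Integration against functions measurable for a sub-sigma-algebra *)

Section pull_out.
Context {d : measure_display} {T : measurableType d} {R : realType}
  (mu : {measure set T -> \bar R}).
Import HBNNSimple.

(** A simple function of [H] splits the integral over finitely many level sets of [H]. These sets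
    are preimages under [H], where equality of integrals over a sub-sigma-algebra can be applied. *)
Let integral_nnsfun_compM (s : {nnsfun R >-> R}) (H U : T -> R) :
  measurable_fun setT H -> measurable_fun setT U -> (forall x, 0 <= U x) ->
  (\int[mu]_x (s (H x) * U x)%:E = \sum_(r \in range s)
     r%:E * \int[mu]_(x in H @^-1` (s @^-1` [set r])) (U x)%:E)%E.
Proof.
move=> mH mU U0.
have mi r : measurable_fun setT (fun x => \1_(s @^-1` [set r]) (H x) : R).
  apply: (measurableT_comp (f := \1_(s @^-1` [set r]) : R -> R) _ mH).
  exact: measurable_indic.
transitivity (\int[mu]_x \sum_(r \in range s)
    ((r * \1_(s @^-1` [set r]) (H x))%:E * (U x)%:E))%E.
  apply: eq_integral => x _.
  rewrite -ge0_mule_fsuml => [|y]; last by rewrite EFinM nnfun_muleindic_ge0.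
  by rewrite fsumEFin// -(fimfunE s).
rewrite ge0_integral_fsum//; last 2 first.
- move=> r; apply/measurable_EFinP/measurable_funM => //.
  exact: measurable_funM.
- by move=> r x _; rewrite mule_ge0 ?lee_fin// -lee_fin EFinM nnfun_muleindic_ge0.
apply: eq_fsbigr => r; rewrite inE => -[x0 _ <-].
under eq_integral do rewrite EFinM -muleA.
rewrite ge0_integralZl ?lee_fin//; last 2 first.
- exact/measurable_EFinP/measurable_funM.
- by move=> x _; rewrite mule_ge0// lee_fin.
congr (_ * _)%E; rewrite [RHS]integral_mkcond.
by apply: eq_integral => x _; rewrite epatch_indic muleC.
Qed.

(** Monotone convergence reduces to simple functions of [H], for which only integrals over preimages
    under [H] occur. The two sides may be infinite. *)
Lemma ge0_integral_pull_out (G : set (set T)) (H U V : T -> R) :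
  (forall B, measurable B -> G (H @^-1` B)) ->
  measurable_fun setT H -> (forall x, 0 <= H x) ->
  measurable_fun setT U -> (forall x, 0 <= U x) ->
  measurable_fun setT V -> (forall x, 0 <= V x) ->
  (forall A, G A -> \int[mu]_(x in A) (U x)%:E = \int[mu]_(x in A) (V x)%:E)%E ->
  (\int[mu]_x (H x * U x)%:E = \int[mu]_x (H x * V x)%:E)%E.
Proof.
move=> GH mH H0 mU U0 mV V0 UV.
(* The approximation is made on the line and then composed with [H], so that the approximants are
   functions of [H]. The absolute value is nonnegative everywhere and is the identity on the values
   of [H]. *)
have mabs : measurable_fun setT (EFin \o (Num.norm : R -> R)).
  exact/measurable_EFinP.
pose s := nnsfun_approx measurableT mabs.
have slim (W : T -> R) : measurable_fun setT W -> (forall x, 0 <= W x) ->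
    (\int[mu]_x (H x * W x)%:E =
     limn (fun n => \int[mu]_x (s n (H x) * W x)%:E))%E.
  move=> mW W0; rewrite -monotone_convergence//.
  - apply: eq_integral => x _; apply/esym/cvg_lim => //.
    under eq_fun do rewrite EFinM.
    rewrite EFinM; apply: cvgeZr => //.
    have := @cvg_nnsfun_approx _ _ _ _ measurableT _ mabs _ (H x) I.
    by rewrite /= ger0_norm//; apply => y _; rewrite lee_fin.
  - move=> n; apply/measurable_EFinP/measurable_funM => //.
    exact: (measurableT_comp (f := s n)).
  - by move=> n x _; rewrite lee_fin mulr_ge0.
  - move=> x _ a b ab; rewrite lee_fin ler_wpM2r//.
    exact/lefP/nd_nnsfun_approx.
rewrite !slim//; congr (limn _); apply/funext => n.
rewrite !integral_nnsfun_compM//; apply: eq_fsbigr => r _; congr (_ * _)%E.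
exact/UV/GH.
Qed.

(** Splitting [W] into positive and negative parts turns the hypothesis into an equality of
    integrals of nonnegative functions; splitting [H] as well reduces to the nonnegative case. *)
Lemma integral_pull_out (G : set (set T)) (H W : T -> R) :
  (forall B, measurable B -> G (H @^-1` B)) ->
  G `<=` measurable ->
  mu.-integrable setT (EFin \o W) ->
  (forall A, G A -> \int[mu]_(x in A) (W x)%:E = 0)%E ->
  measurable_fun setT H ->
  mu.-integrable setT (EFin \o (fun x => H x * W x)) ->
  (\int[mu]_x (H x * W x)%:E = 0)%E.
Proof.
move=> GH mG iW W0 mH iHW.
have mW : measurable_fun setT W by exact/measurable_EFinP/(measurable_int _ iW).
have normE (f : T -> R) x : `|f x| = f^\+ x + f^\- x.
  by rewrite -[LHS]/((Num.norm \o f) x) -funrposDneg.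
have WE A : G A -> (\int[mu]_(x in A) (W^\+ x)%:E = \int[mu]_(x in A) (W^\- x)%:E)%E.
  move=> GA; have mA := mG _ GA.
  have iA : mu.-integrable A (EFin \o W) by exact: integrableS iW.
  have ip := integrable_funrpos mA iA; have iq := integrable_funrneg mA iA.
  have fp := integrable_fin_num mA ip; have fq := integrable_fin_num mA iq.
  have : (\int[mu]_(x in A) (W^\+ x)%:E - \int[mu]_(x in A) (W^\- x)%:E = 0)%E.
    rewrite -integralB_EFin// -[RHS](W0 _ GA); apply: eq_integral => x _.
    by rewrite -EFinB -[in RHS](funrposBneg W).
  rewrite -(fineK fp) -(fineK fq) => -[/eqP].
  by rewrite subr_eq0 => /eqP ->.
(* [K] will be the positive or the negative part of [H]; domination by [H] makes [K] times either
   part of [W] integrable. *)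
have pos (K : T -> R) : (forall B, measurable B -> G (K @^-1` B)) -> measurable_fun setT K ->
    (forall x, 0 <= K x <= `|H x|) -> (\int[mu]_x (K x * W x)%:E = 0)%E.
  move=> GK mK K0.
  have iK (W' : T -> R) : measurable_fun setT W' -> (forall x, `|W' x| <= `|W x|) ->
      mu.-integrable setT (EFin \o (fun x => K x * W' x)).
    move=> mW' W'W; apply: le_integrable iHW => //.
      exact/measurable_EFinP/measurable_funM.
    move=> x _ /=; rewrite lee_fin !normrM.
    have /andP[K0x KH] := K0 x.
    by rewrite ler_pM// ger0_norm.
  have mWp := measurable_funrpos mW. have mWn := measurable_funrneg mW.
  transitivity (\int[mu]_x ((K x * W^\+ x)%:E - (K x * W^\- x)%:E))%E.
    apply: eq_integral => x _; rewrite -EFinB -mulrBr.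
    by rewrite -[in LHS](funrposBneg W).
  have iKp : mu.-integrable setT (EFin \o (fun x => K x * W^\+ x)).
    apply: iK => // x; rewrite ger0_norm//.
    by rewrite normE lerDl.
  have iKn : mu.-integrable setT (EFin \o (fun x => K x * W^\- x)).
    apply: iK => // x; rewrite ger0_norm//.
    by rewrite normE lerDr.
  rewrite integralB_EFin// (@ge0_integral_pull_out G K W^\+ W^\-)//.
    by rewrite subee//; exact: integrable_fin_num iKn.
  by move=> x; case/andP: (K0 x).
have Hp : (\int[mu]_x (H^\+ x * W x)%:E = 0)%E.
  apply: pos => [B mB| |x]; last 2 first.
  - exact: measurable_funrpos.
  - by rewrite funrpos_ge0 normE lerDl funrneg_ge0.
  apply: (GH ((fun r : R => Num.max r 0) @^-1` B)).
  rewrite -[X in measurable X]setTI.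
  exact: (measurable_funrpos (@measurable_id _ R setT) measurableT mB).
have Hn : (\int[mu]_x (H^\- x * W x)%:E = 0)%E.
  apply: pos => [B mB| |x]; last 2 first.
  - exact: measurable_funrneg.
  - by rewrite funrneg_ge0 normE lerDr funrpos_ge0.
  apply: (GH ((fun r : R => Num.max (- r) 0) @^-1` B)).
  rewrite -[X in measurable X]setTI.
  exact: (measurable_funrneg (@measurable_id _ R setT) measurableT mB).
transitivity (\int[mu]_x ((H^\+ x * W x)%:E - (H^\- x * W x)%:E))%E.
  apply: eq_integral => x _; rewrite -EFinB -mulrBl.
  by rewrite -[in LHS](funrposBneg H).
rewrite integralB_EFin//; [by rewrite Hp Hn sube0| |].
  apply: le_integrable iHW => //.
    exact/measurable_EFinP/measurable_funM/mW/measurable_funrpos.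
  move=> x _ /=; rewrite lee_fin !normrM ler_wpM2r// ger0_norm//.
  by rewrite normE lerDl.
apply: le_integrable iHW => //.
  exact/measurable_EFinP/measurable_funM/mW/measurable_funrneg.
move=> x _ /=; rewrite lee_fin !normrM ler_wpM2r// ger0_norm//.
by rewrite normE lerDr.
Qed.
End pull_out.

(** * Conditional expectation *)

Section regression.
Context {d d' : measure_display} {T : measurableType d} {S : measurableType d'}
  {R : realType} (P : probability T R) (f : {mfun T >-> S}).

(** The regression function is the Radon-Nikodym derivative, with respect to the law of [f], of the
    image under [f] of the signed measure with density [U]. *)
Lemma exists_regression (U : T -> R) : P.-integrable setT (EFin \o U) ->
  exists h : S -> R, [/\ measurable_fun setT h,
    (distribution P f).-integrable setT (EFin \o h)
    & forall B, measurable B -> (\int[distribution P f]_(y in B) (h y)%:E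
        = \int[P]_(w in f @^-1` B) (U w)%:E)%E].
Proof.
move=> iU.
have mf : measurable_fun setT f by [].
have mpre B : measurable B -> measurable (f @^-1` B).
  by move=> mB; rewrite -[X in measurable X]setTI; exact: mf.
(* The measurability of [f] parametrizes this instance, so it is given by name. *)
pose nu : {charge set S -> \bar R} :=
  measure_function_pushforward__canonical__charge_Charge (induced_charge iU) mf.
have nuP : nu `<< distribution P f.
  apply/null_content_dominatesP => A mA PA0; apply: null_set_integral => //.
    exact: mpre.
  exact/measurable_funTS/(measurable_int _ iU).
pose h := Radon_Nikodym nu (distribution P f).
have hfin y : h y \is a fin_num by exact: Radon_Nikodym_fin_num.
have hE : EFin \o (fine \o h) = h by apply/funext => y /=; rewrite fineK.
have ih : (distribution P f).-integrable setT h by exact: Radon_Nikodym_integrable.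
exists (fine \o h); split.
- by apply/measurable_EFinP; rewrite hE; exact: measurable_int ih.
- by rewrite hE.
- move=> B mB; under eq_integral do rewrite fineK//.
  by rewrite -Radon_Nikodym_integral.
Qed.

Lemma is_cexp_comp (U : T -> R) (h : S -> R) :
  measurable_fun setT h -> (distribution P f).-integrable setT (EFin \o h) ->
  (forall B, measurable B -> (\int[distribution P f]_(y in B) (h y)%:E
        = \int[P]_(w in f @^-1` B) (U w)%:E)%E) ->
  is_cexp P (g_sigma_algebra_preimage f) U (h \o f).
Proof.
move=> mh ih hU.
have mf : measurable_fun setT f by [].
have ihf : P.-integrable setT (EFin \o (h \o f)).
  apply/integrableP; split.
    exact/measurable_EFinP/measurableT_comp.
  move/integrableP : ih => [_]; rewrite ge0_integral_pushforward//.
  exact/measurableT_comp/measurable_EFinP.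
split=> [B mB||A [B mB <-]]//.
  rewrite comp_preimage; exists (h @^-1` B); rewrite ?setTI//.
  by rewrite -[X in measurable X]setTI; exact: mh.
rewrite setTI -hU// integral_pushforward//; first exact/measurable_EFinP.
apply: integrableS ihf => //.
by rewrite -[X in measurable X]setTI; exact: mf.
Qed.

End regression.

Section integral_tools.
Context {d : measure_display} {T : measurableType d} {R : realType}
  (mu : {measure set T -> \bar R}).

Lemma integralB_eq0 (D : set T) (U V : T -> R) : measurable D ->
  mu.-integrable D (EFin \o U) -> mu.-integrable D (EFin \o V) ->
  (\int[mu]_(x in D) (U x - V x)%:E = 0)%E <->
  (\int[mu]_(x in D) (U x)%:E = \int[mu]_(x in D) (V x)%:E)%E.
Proof.
move=> mD iU iV.
have fU := integrable_fin_num mD iU; have fV := integrable_fin_num mD iV.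
under eq_integral do rewrite EFinB; rewrite integralB_EFin//.
rewrite -(fineK fU) -(fineK fV) -EFinB; split=> [[/eqP]|[->]].
  by rewrite subr_eq0 => /eqP ->.
by rewrite subrr.
Qed.

(** The set where [V] is negative lies in [G], so the integral of [V] over it is both nonpositive
    and nonnegative. Hence [V] vanishes almost everywhere there, and the set is null. *)
Lemma ae_ge0_integral (G : set (set T)) (V : T -> R) :
  (forall B, measurable B -> G (V @^-1` B)) -> G `<=` measurable ->
  mu.-integrable setT (EFin \o V) ->
  (forall A, G A -> (0 <= \int[mu]_(x in A) (V x)%:E)%E) ->
  {ae mu, forall x, 0 <= V x}.
Proof.
move=> GV mG iV V0; pose A := V @^-1` [set` `]-oo, 0[].
have GA : G A by exact: GV.
have mA := mG _ GA.
have Aneg x : A x -> V x < 0 by rewrite /A /= in_itv.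
have mV : measurable_fun A (EFin \o V).
  exact: measurable_funTS (measurable_int _ iV).
have : ae_eq mu A (EFin \o V) (cst 0%E).
  apply/ae_eq_integral_abs => //; apply/eqP; rewrite eq_le integral_ge0// andbT.
  rewrite -[leLHS]oppeK leeNl oppe0 -integral_ge0N//.
  rewrite (eq_integral (EFin \o V)) ?V0// => x /set_mem Ax.
  by rewrite lte0_abs ?oppeK// lte_fin Aneg.
apply: filterS => x /= AV0; rewrite leNgt; apply/negP => Vx.
have Ax : A x by rewrite /A /= in_itv.
by move: Vx; have [->] := AV0 Ax; rewrite ltxx.
Qed.
Lemma integrable_lincomb (n : nat) (a : 'I_n -> R) (U : 'I_n -> T -> R) :
  (forall i, mu.-integrable setT (EFin \o U i)) ->
  mu.-integrable setT (EFin \o (fun x => \sum_i a i * U i x)).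
Proof.
move=> iU.
rewrite (_ : EFin \o _ = (fun x => \sum_i ((a i)%:E * (U i x)%:E))%E); last first.
  by apply/funext => x /=; rewrite -sumEFin.
by apply: integrable_sum => // i _; exact: (integrableZl measurableT (a i) (iU i)).
Qed.

End integral_tools.

Section sigma_algebra_of_function.
Context {d d' : measure_display} {T : measurableType d} {S : measurableType d'}
  {R : realType} (f : {mfun T >-> S}).
Local Notation sigf := (g_sigma_algebra_preimage f).

Lemma sigma_algebra_preimage_measurable : sigf `<=` measurable.
Proof. by move=> A [B mB <-]; exact: measurable_funP. Qed.

(** The condition on preimages used in [is_cexp] becomes measurability on a retyped domain, where
    closure under sums, products and maxima is available. *)
Lemma sigma_algebra_preimage_funP (V : T -> R) :
  (forall B, measurable B -> sigf (V @^-1` B)) <->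
  measurable_fun setT (V : g_sigma_algebra_preimageType f -> R).
Proof.
split=> [mV _ B mB|mV B mB]; first by rewrite setTI; exact: mV.
by rewrite -[_ @^-1` _]setTI; exact: mV.
Qed.

Lemma measurable_sigma_algebra_preimage (V : T -> R) :
  measurable_fun setT (V : g_sigma_algebra_preimageType f -> R) ->
  measurable_fun setT V.
Proof.
move=> mV _ B mB; have [C mC <-] := mV measurableT B mB.
by apply: measurable_funP.
Qed.

End sigma_algebra_of_function.

Section conditional_expectation.
Context {d d' : measure_display} {T : measurableType d} {S : measurableType d'}
  {R : realType} (P : probability T R) (f : {mfun T >-> S}).
Local Notation sigf := (g_sigma_algebra_preimage f).

(** Since [cexp] is selected by choice, it is a genuine version as soon as one exists; the
    regression function composed with [f] is one. *)
Lemma cexpP (U : T -> R) : P.-integrable setT (EFin \o U) ->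
  is_cexp P sigf U (cexp P sigf U).
Proof.
move=> /(exists_regression f)[h [mh ih hU]].
apply: (@xgetPex _ (cst 0 : T -> R) [set V | is_cexp P sigf U V]).
by exists (h \o f); exact: is_cexp_comp.
Qed.

Lemma is_cexp_measurable (U V : T -> R) : is_cexp P sigf U V ->
  measurable_fun setT (V : g_sigma_algebra_preimageType f -> R).
Proof. by case=> /sigma_algebra_preimage_funP. Qed.

Lemma is_cexp_id (U : T -> R) : P.-integrable setT (EFin \o U) ->
  measurable_fun setT (U : g_sigma_algebra_preimageType f -> R) ->
  is_cexp P sigf U U.
Proof. by move=> iU mU; split=> //; exact/sigma_algebra_preimage_funP. Qed.

Lemma is_cexpB0 (U V : T -> R) : P.-integrable setT (EFin \o U) ->
  is_cexp P sigf U V ->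
  forall A, sigf A -> (\int[P]_(w in A) (U w - V w)%:E = 0)%E.
Proof.
move=> iU [_ iV UV] A sA.
have mA := sigma_algebra_preimage_measurable sA.
by apply/integralB_eq0; rewrite ?UV//; [exact: integrableS iU|exact: integrableS iV].
Qed.

Lemma is_cexpZD (a b : R) (U U' V V' : T -> R) :
  P.-integrable setT (EFin \o U) -> P.-integrable setT (EFin \o U') ->
  is_cexp P sigf U V -> is_cexp P sigf U' V' ->
  is_cexp P sigf (fun w => a * U w + b * U' w) (fun w => a * V w + b * V' w).
Proof.
move=> iU iU' UV UV'.
have mV := is_cexp_measurable UV; have mV' := is_cexp_measurable UV'.
case: UV UV' => _ iV eV [_ iV' eV'].
have lin (A : set T) (W W' : T -> R) : measurable A ->
  P.-integrable setT (EFin \o W) -> P.-integrable setT (EFin \o W') ->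
  P.-integrable A (EFin \o (fun w => a * W w + b * W' w)) /\
  (\int[P]_(w in A) (a * W w + b * W' w)%:E =
   a%:E * \int[P]_(w in A) (W w)%:E + b%:E * \int[P]_(w in A) (W' w)%:E)%E.
  move=> mA iW iW'.
  have iWA := integrableS measurableT mA (@subsetT _ _) iW.
  have iWA' := integrableS measurableT mA (@subsetT _ _) iW'.
  have i1 := integrableZl mA a iWA; have i2 := integrableZl mA b iWA'.
  split; first exact: eq_integrable (integrableD mA i1 i2).
  rewrite -!integralZl// -integralD//.
split.
- apply/sigma_algebra_preimage_funP.
  by apply: measurable_funD; apply: measurable_funM.
- exact: (lin setT V V' _ _ _).1.
- move=> A sA; have mA := sigma_algebra_preimage_measurable sA.
  by rewrite (lin A V V' _ _ _).2// (lin A U U' _ _ _).2// eV// eV'.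
Qed.

Lemma is_cexp_sum (n : nat) (a : 'I_n -> R) (U V : 'I_n -> T -> R) :
  (forall i, P.-integrable setT (EFin \o U i)) ->
  (forall i, is_cexp P sigf (U i) (V i)) ->
  is_cexp P sigf (fun w => \sum_i a i * U i w) (fun w => \sum_i a i * V i w).
Proof.
move=> iU UV; elim: n a U V iU UV => [|n IH] a U V iU UV.
  under eq_fun do rewrite big_ord0.
  rewrite [X in is_cexp _ _ _ X](_ : _ = cst 0); last first.
    by apply/funext => w; rewrite big_ord0.
  apply: is_cexp_id; last exact: measurable_cst.
  exact: finite_measure_integrable_cst.
under eq_fun do rewrite big_ord_recr/= -[X in X + _]mul1r.
rewrite [X in is_cexp _ _ _ X](_ : _ = (fun w =>
  1 * (\sum_(i < n) a (widen_ord (leqnSn n) i) * V (widen_ord (leqnSn n) i) w)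
  + a ord_max * V ord_max w)).
  apply: is_cexpZD => //.
    by apply: integrable_lincomb => i; exact: iU.
  by apply: (IH _ (fun i => U (widen_ord (leqnSn n) i))) => i; [exact: iU|exact: UV].
by apply/funext => w; rewrite big_ord_recr/= mul1r.
Qed.

(** The difference of two versions integrates to 0 over the sigma-algebra, so it is almost
    everywhere nonnegative, and so is its opposite. *)
Lemma is_cexp_unique (U V V' : T -> R) :
  is_cexp P sigf U V -> is_cexp P sigf U V' -> {ae P, forall w, V w = V' w}.
Proof.
move=> UV UV'.
have le W W' : is_cexp P sigf U W -> is_cexp P sigf U W' ->
    {ae P, forall w, 0 <= W w - W' w}.
  move=> UW UW'; have mW := is_cexp_measurable UW.
  have mW' := is_cexp_measurable UW'; case: UW UW' => _ iW eW [_ iW' eW'].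
  have mS := @sigma_algebra_preimage_measurable _ _ _ _ f.
  apply: (ae_ge0_integral _ mS).
  - exact/sigma_algebra_preimage_funP/measurable_funB.
  - exact: eq_integrable (integrableB _ iW iW').
  - move=> A sA; have mA := mS _ sA.
    rewrite (integralB_eq0 mA _ _).2 ?eW ?eW'//.
    + exact: integrableS iW.
    + exact: integrableS iW'.
apply: filterS2 (le _ _ UV UV') (le _ _ UV' UV) => w.
by rewrite !subr_ge0 => h1 h2; apply/eqP; rewrite eq_le h1 h2.
Qed.

End conditional_expectation.

Section almost_everywhere.
Context {d : measure_display} {T : measurableType d} {R : realType}
  (mu : {measure set T -> \bar R}).

Lemma ae_eq_integrable (U V : T -> R) : measurable_fun setT V ->
  {ae mu, forall x, U x = V x} ->
  mu.-integrable setT (EFin \o U) -> mu.-integrable setT (EFin \o V).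
Proof.
move=> mV UV /integrableP[mU iU]; apply/integrableP; split.
  exact/measurable_EFinP.
rewrite (ge0_ae_eq_integral (g := abse \o (EFin \o U)))//.
- exact/measurableT_comp/measurable_EFinP.
- exact/measurableT_comp.
- by move=> x _ /=.
- by apply: filterS UV => x /= ->.
Qed.

Lemma ae_eq_integral_EFin (A : set T) (U V : T -> R) : measurable A ->
  measurable_fun setT U -> measurable_fun setT V ->
  {ae mu, forall x, U x = V x} ->
  (\int[mu]_(x in A) (U x)%:E = \int[mu]_(x in A) (V x)%:E)%E.
Proof.
move=> mA mU mV UV; apply: ae_eq_integral => //.
- exact/measurable_EFinP/measurable_funTS.
- exact/measurable_EFinP/measurable_funTS.
- by apply: filterS UV => x /= ->.
Qed.

Lemma integralM_indic (A : set T) (W : T -> R) :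
  (\int[mu]_x (W x * \1_A x)%:E = \int[mu]_(x in A) (W x)%:E)%E.
Proof.
by rewrite [RHS]integral_mkcond; apply: eq_integral => x _; rewrite epatch_indic.
Qed.

Lemma integrableM_bounded (H W : T -> R) : measurable_fun setT H ->
  (exists M, forall x, `|H x| <= M) ->
  mu.-integrable setT (EFin \o W) ->
  mu.-integrable setT (EFin \o (fun x => H x * W x)).
Proof.
move=> mH [M HM] iW; apply: eq_integrable (integrableMr _ mH _ iW) => //.
exists M; split; first exact: num_real.
by move=> y My x _; apply: (le_trans (HM x)); exact: ltW.
Qed.

End almost_everywhere.

(** * Conditional independence and vanishing conditional expectations *)

Section conditional_independence.
Context {d d1 d2 d3 : measure_display} {T : measurableType d}
  {S1 : measurableType d1} {S2 : measurableType d2} {S3 : measurableType d3}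
  {R : realType} (P : probability T R).
Implicit Types (f : {mfun T >-> S1}) (g : {mfun T >-> S2}) (h : {mfun T >-> S3}).

Lemma is_cexp_ae h (U V V' : T -> R) :
  is_cexp P (g_sigma_algebra_preimage h) U V ->
  measurable_fun setT (V' : g_sigma_algebra_preimageType h -> R) ->
  {ae P, forall w, V w = V' w} ->
  is_cexp P (g_sigma_algebra_preimage h) U V'.
Proof.
move=> UV mV' VV'.
have mV := measurable_sigma_algebra_preimage (is_cexp_measurable UV).
have mTV' := measurable_sigma_algebra_preimage mV'.
case: UV => sV iV eV; split.
- exact/sigma_algebra_preimage_funP.
- exact: ae_eq_integrable iV.
- move=> A sA; rewrite -eV//; apply/esym/ae_eq_integral_EFin => //.
  exact: sigma_algebra_preimage_measurable sA.
Qed.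

Lemma integrable_indic_EFin (A : set T) : measurable A ->
  P.-integrable setT (EFin \o (\1_A : T -> R)).
Proof.
by move=> mA; apply: integrable_indic => //; rewrite fin_num_measure.
Qed.

(** A conditional probability lies in [0, 1] only almost everywhere. Truncating it gives a version
    bounded everywhere, whose products with integrable functions are integrable. *)
Lemma exists_cprob h (A : set T) : measurable A ->
  exists pi : T -> R, [/\ is_cexp P (g_sigma_algebra_preimage h) \1_A pi,
    forall w, 0 <= pi w <= 1 &
    {ae P, forall w, cprob P (g_sigma_algebra_preimage h) A w = pi w}].
Proof.
move=> mA; have iA := integrable_indic_EFin mA.
set V := cprob P _ A.
have AV : is_cexp P (g_sigma_algebra_preimage h) \1_A V by exact: cexpP.
have mV := is_cexp_measurable AV.
have V0 (U W : T -> R) : is_cexp P (g_sigma_algebra_preimage h) U W ->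
    (forall w, 0 <= U w) -> {ae P, forall w, 0 <= W w}.
  move=> [sW iW UW] U0; apply: (ae_ge0_integral sW _ iW).
    exact: sigma_algebra_preimage_measurable.
  by move=> B sB; rewrite UW// integral_ge0// => w _; rewrite lee_fin.
have i1 : P.-integrable setT (EFin \o (cst 1 : T -> R)).
  exact: finite_measure_integrable_cst.
have c1 : is_cexp P (g_sigma_algebra_preimage h) (cst 1) (cst 1).
  by apply: is_cexp_id.
(* Nonnegativity of this version of the conditional probability of the complement gives the upper
   bound. *)
have V1 := is_cexpZD 1 (-1) i1 iA c1 AV.
have mpi : measurable_fun setT
    ((fun w => Num.max 0 (Num.min 1 (V w))) : g_sigma_algebra_preimageType h -> R).
  by apply: measurable_maxr => //; apply: measurable_minr.
have aeV : {ae P, forall w, V w = Num.max 0 (Num.min 1 (V w))}.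
  apply: filterS2 (V0 _ _ AV _) (V0 _ _ V1 _) => [w|w|w].
  - move=> Vw0; rewrite mul1r mulN1r subr_ge0 => Vw1.
    by rewrite (min_idPr Vw1) (max_idPr Vw0).
  - by rewrite indicE.
  - by rewrite mul1r mulN1r subr_ge0 indicE; case: (_ \in _).
exists (fun w => Num.max 0 (Num.min 1 (V w))); split => //.
- exact: is_cexp_ae AV mpi aeV.
- by move=> w; rewrite le_max lexx/= ge_max ler01 ge_min lexx.
Qed.

(* With [pi] a version of P(A | h) valued in [0, 1], conditional independence
   makes [\1_A - pi] integrate to 0 over the sigma-algebra of [g], so that
   E[\1_A W] = E[pi W]; the latter is 0 because [pi] is measurable for [h]. *)
Lemma cond_indep_integral0 f g h (W : T -> R) :
  cond_indep P (g_sigma_algebra_preimage f) (g_sigma_algebra_preimage g)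
    (g_sigma_algebra_preimage h) ->
  measurable_fun setT (W : g_sigma_algebra_preimageType g -> R) ->
  P.-integrable setT (EFin \o W) ->
  (forall C, g_sigma_algebra_preimage h C ->
    \int[P]_(w in C) (W w)%:E = 0)%E ->
  forall A, g_sigma_algebra_preimage f A -> (\int[P]_(w in A) (W w)%:E = 0)%E.
Proof.
move=> CI mW iW W0 A sA.
have sfm := @sigma_algebra_preimage_measurable _ _ _ _ f.
have sgm := @sigma_algebra_preimage_measurable _ _ _ _ g.
have shm := @sigma_algebra_preimage_measurable _ _ _ _ h.
have mA := sfm _ sA; have iA := integrable_indic_EFin mA.
have [pi [Api pi01 aepi]] := exists_cprob h mA.
have mpi := is_cexp_measurable Api.
have mTpi := measurable_sigma_algebra_preimage mpi.
have [spi ipi _] := Api.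
have bpi : exists M, forall w, `|pi w| <= M.
  by exists 1 => w; have /andP[p0 p1] := pi01 w; rewrite ger0_norm.
have iApi : P.-integrable setT (EFin \o (fun w => \1_A w - pi w)).
  exact: eq_integrable (integrableB _ iA ipi).
have Ag C : g_sigma_algebra_preimage g C ->
    (\int[P]_(w in C) (\1_A w - pi w)%:E = 0)%E.
  move=> sC; have mC := sgm _ sC; have iC := integrable_indic_EFin mC.
  have Ckappa := cexpP h iC; set kappa := cexp _ _ _ in Ckappa.
  have mkappa := measurable_sigma_algebra_preimage (is_cexp_measurable Ckappa).
  have [_ ikappa _] := Ckappa.
  have iCk : P.-integrable setT (EFin \o (fun w => \1_C w - kappa w)).
    exact: eq_integrable (integrableB _ iC ikappa).
  have mAC : measurable (A `&` C) by exact: measurableI.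
  have iAC := integrable_indic_EFin mAC.
  have ACcexp := cexpP h iAC.
  have mACcexp := measurable_sigma_algebra_preimage (is_cexp_measurable ACcexp).
  (* [pi] is measurable for the sigma-algebra of [h], so under it [\1_C] may be replaced by its
     conditional expectation [kappa]. *)
  have e1 : (\int[P]_w (pi w * (\1_C w - kappa w))%:E = 0)%E.
    apply: (integral_pull_out spi shm iCk (is_cexpB0 iC Ckappa)) => //.
    exact: integrableM_bounded.
  have i1 : P.-integrable setT (EFin \o (fun w => pi w * \1_C w)).
    exact: integrableM_bounded.
  have i2 : P.-integrable setT (EFin \o (fun w => pi w * kappa w)).
    exact: integrableM_bounded.
  have {}e1 : (\int[P]_w (pi w * \1_C w)%:E = \int[P]_w (pi w * kappa w)%:E)%E.
    by apply/integralB_eq0 => //; under eq_integral do rewrite -mulrBr.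
  rewrite integralM_indic in e1.
  apply/(integralB_eq0 mC); [exact: integrableS iA|exact: integrableS ipi|].
  (* Conditional independence identifies the product [pi * kappa] with the conditional probability
     of the intersection, whose integral over the whole space is that of its indicator. *)
  rewrite e1 [RHS](ae_eq_integral_EFin (V := cprob P (g_sigma_algebra_preimage h) (A `&` C)))//.
  - case: ACcexp => _ _ ->; last first.
      by exists setT; [exact: measurableT|rewrite setTI preimage_setT].
    by rewrite -integralM_indic; apply: eq_integral => w _; rewrite indicI.
  - exact: measurable_funM.
  - by apply: filterS2 aepi (CI _ _ sA sC) => w <- ->.
have mTW := measurable_sigma_algebra_preimage mW.
have iWA : P.-integrable setT (EFin \o (fun w => W w * \1_A w)).
  rewrite (_ : (fun w => _) = (fun w => \1_A w * W w)); last first.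
    by apply/funext => w; rewrite mulrC.
  apply: integrableM_bounded => //.
  by exists 1 => w; rewrite indicE; case: (_ \in _); rewrite ?normr1 ?normr0.
have ipiW : P.-integrable setT (EFin \o (fun w => pi w * W w)).
  exact: integrableM_bounded.
have iWpi : P.-integrable setT (EFin \o (fun w => W w * pi w)).
  by apply: eq_integrable ipiW => // w _ /=; rewrite mulrC.
(* Here [W] is the multiplier, measurable for the sigma-algebra of [g], and [\1_A - pi] is the
   function with zero integrals. At the end [pi] is the multiplier and [W] the function with zero
   integrals. *)
have e2 : (\int[P]_w (W w * (\1_A w - pi w))%:E = 0)%E.
  apply: (integral_pull_out _ sgm iApi Ag) => //.
    exact/sigma_algebra_preimage_funP.
  apply: eq_integrable (integrableB _ iWA iWpi) => // w _.
  by rewrite /= -EFinB mulrBr.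
rewrite -integralM_indic.
transitivity (\int[P]_w (W w * pi w)%:E)%E.
  by apply/integralB_eq0 => //; under eq_integral do rewrite -mulrBr.
under eq_integral do rewrite mulrC.
exact: (integral_pull_out spi shm iW W0).
Qed.

End conditional_independence.

(** * Orthogonal projections *)

Section orthogonal_projection.
Context {R : realType} {p : nat}.
Implicit Types (u v : 'cV[R]_p) (E : {vspace 'cV[R]_p}).

Lemma dotvE u v : dotv u v = \sum_i u i ord0 * v i ord0.
Proof. by rewrite /dotv mxE; apply: eq_bigr => i _; rewrite mxE. Qed.

Lemma dotvBr u v w : dotv u (v - w) = dotv u v - dotv u w.
Proof. by rewrite /dotv mulmxBr !mxE. Qed.

Lemma dotv_mx (m : nat) (a b : 'rV[R]_m) (B : 'M[R]_(m, p)) :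
  dotv ((a *m B)^T) ((b *m B)^T) = (a *m (B *m B^T) *m b^T) ord0 ord0.
Proof. by rewrite /dotv trmxK !trmx_mul !mulmxA. Qed.

Lemma enorm2 v : enorm v ^+ 2 = dotv v v.
Proof.
rewrite /enorm sqr_sqrtr ?sumr_ge0// => [|i _]; last exact: sqr_ge0.
by rewrite dotvE; apply: eq_bigr => i _; rewrite expr2.
Qed.

Lemma dotv_eq0 v : (dotv v v == 0) = (v == 0).
Proof.
apply/eqP/eqP => [|->]; last by rewrite /dotv mulmx0 mxE.
rewrite dotvE => /eqP; rewrite psumr_eq0 => [/allP v0|i _]; last first.
  by rewrite -expr2 sqr_ge0.
apply/colP => i; rewrite mxE; apply/eqP.
by have := v0 i (mem_index_enum _); rewrite mulf_eq0 orbb.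
Qed.

Lemma mulmx_cV_inj (m : nat) (A B : 'M[R]_(m, p)) :
  (forall v : 'cV_p, A *m v = B *m v) -> A = B.
Proof.
move=> AB; apply/matrixP => i j.
by have /colP/(_ i) := AB (delta_mx j ord0); rewrite -!colE !mxE.
Qed.

(** The basis vectors are the rows, so the elements of [E] are the transposes of
    [c *m basis_mx E]. *)
Definition basis_mx E : 'M[R]_(\dim E, p) :=
  \matrix_(i, j) (vbasis E)`_i j ord0.

Lemma row_mul_basis_mx E (c : 'rV[R]_(\dim E)) :
  (c *m basis_mx E)^T = \sum_i c ord0 i *: (vbasis E)`_i.
Proof.
apply/colP => j; rewrite !mxE summxE; apply: eq_bigr => i _.
by rewrite !mxE.
Qed.

Lemma row_mul_basis_mx_in E (c : 'rV[R]_(\dim E)) : (c *m basis_mx E)^T \in E.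
Proof.
rewrite row_mul_basis_mx memv_suml// => i _; apply/memvZ/vbasis_mem.
by rewrite mem_nth// size_tuple.
Qed.

Lemma in_row_mul_basis_mx E v : v \in E ->
  exists c : 'rV[R]_(\dim E), v = (c *m basis_mx E)^T.
Proof.
move=> vE; exists (\row_i coord (vbasis E) i v).
rewrite row_mul_basis_mx {1}(coord_vbasis vE).
by apply: eq_bigr => i _; rewrite mxE.
Qed.

(** A row [c] in the kernel of the Gram matrix yields a combination of basis vectors of norm 0;
    freeness of the basis forces [c] to be 0. *)
Lemma gram_unitmx E : basis_mx E *m (basis_mx E)^T \in unitmx.
Proof.
rewrite -row_free_unit -kermx_eq0; apply/rowV0P => c /sub_kermxP cG.
have : (c *m basis_mx E)^T == 0 by rewrite -dotv_eq0 dotv_mx cG mul0mx mxE.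
rewrite row_mul_basis_mx => /eqP c0; apply/rowP => i; rewrite mxE.
have /freeP := basis_free (vbasisP E); exact.
Qed.

(** The classical formula for the projection in terms of a basis, which serves as an explicit
    witness for [orth_proj]. *)
Definition gram_proj E : 'M[R]_p :=
  (basis_mx E)^T *m invmx (basis_mx E *m (basis_mx E)^T) *m basis_mx E.

Lemma gram_projT E : (gram_proj E)^T = gram_proj E.
Proof.
by rewrite /gram_proj !trmx_mul trmxK trmx_inv trmx_mul trmxK mulmxA.
Qed.

Lemma gram_proj_in E v : gram_proj E *m v \in E.
Proof.
rewrite -[gram_proj E *m v]trmxK trmx_mul gram_projT /gram_proj !mulmxA.
exact: row_mul_basis_mx_in.
Qed.

Lemma gram_proj_id E v : v \in E -> gram_proj E *m v = v.
Proof.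
move=> /in_row_mul_basis_mx[c ->]; apply: trmx_inj.
rewrite trmx_mul gram_projT trmxK /gram_proj !mulmxA -(mulmxA c).
by rewrite mulmxK// gram_unitmx.
Qed.

Lemma dotv_mulmx u v (A : 'M[R]_p) : dotv u (A *m v) = dotv (A^T *m u) v.
Proof. by rewrite /dotv trmx_mul trmxK mulmxA. Qed.

(** For two orthogonal projections, the difference of the images of [v] lies in [E] and is
    orthogonal to [E], hence to itself. *)
Lemma orth_projE E : orth_proj E = gram_proj E.
Proof.
have GP v : gram_proj E *m v \in E /\
    forall u, u \in E -> dotv u (v - gram_proj E *m v) = 0.
  split=> [|u uE]; first exact: gram_proj_in.
  by rewrite dotvBr dotv_mulmx gram_projT gram_proj_id// subrr.
have QP : forall v, orth_proj E *m v \in E /\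
    forall u, u \in E -> dotv u (v - orth_proj E *m v) = 0.
  exact: (@xgetPex _ (0 : 'M[R]_p) [set Q : 'M[R]_p | forall v : 'cV[R]_p,
    Q *m v \in E /\ forall u, u \in E -> dotv u (v - Q *m v) = 0] (ex_intro _ _ GP)).
apply: mulmx_cV_inj => v; apply/eqP; rewrite -subr_eq0 -dotv_eq0.
have [QE Qv] := QP v; have [GE Gv] := GP v; have wE := rpredB QE GE.
have -> : dotv (orth_proj E *m v - gram_proj E *m v)
    (orth_proj E *m v - gram_proj E *m v) =
  dotv (orth_proj E *m v - gram_proj E *m v) (v - gram_proj E *m v) -
  dotv (orth_proj E *m v - gram_proj E *m v) (v - orth_proj E *m v).
  by rewrite !dotvBr opprB [RHS]addrC addrA subrK.
by rewrite Qv// Gv// subrr.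
Qed.

Lemma dotv_orth_proj_sub E u v : u \in E -> dotv u (v - orth_proj E *m v) = 0.
Proof.
move=> uE; rewrite dotvBr dotv_mulmx orth_projE.
by rewrite gram_projT gram_proj_id// subrr.
Qed.

(** By cyclicity the trace is that of an identity matrix of order [\dim E]. It provides the factor p
    - d in the conditional variance. *)
Lemma mxtrace_orth_proj E : \tr (orth_proj E) = (\dim E)%:R.
Proof.
by rewrite orth_projE /gram_proj mxtrace_mulC !mulmxA mulmxV ?gram_unitmx// mxtrace1.
Qed.

Lemma orth_projT E : (orth_proj E)^T = orth_proj E.
Proof. by rewrite orth_projE gram_projT. Qed.

Lemma orth_proj_id E v : v \in E -> orth_proj E *m v = v.
Proof. by rewrite orth_projE; exact: gram_proj_id. Qed.

Lemma orth_proj_in E v : orth_proj E *m v \in E.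
Proof. by rewrite orth_projE gram_proj_in. Qed.

Lemma orth_proj_idem E : orth_proj E *m orth_proj E = orth_proj E.
Proof.
by apply: mulmx_cV_inj => v; rewrite -mulmxA orth_proj_id// orth_proj_in.
Qed.

End orthogonal_projection.

(** * Symmetric matrices of maximal rank *)

Section rank_increase.
Context {F : numFieldType}.

Lemma exists_pos_nonroot (q : {poly F}) : q != 0 -> exists2 s : F, 0 < s & ~~ root q s.
Proof.
move=> q0; have [//|noroot] := pselect (exists2 s : F, 0 < s & ~~ root q s).
(* The integers from 1 to [size q] exceed the degree by one in number, so they cannot all be
   roots. *)
have := @max_poly_roots _ q [seq i.+1%:R | i <- iota 0 (size q)] q0.
rewrite size_map size_iota ltnn => H; case: notF; apply: H.
- apply/allP => _ /mapP[i _ ->]; apply/negPn/negP => qi.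
  by apply: noroot; exists i.+1%:R => //; rewrite ltr0n.
- rewrite map_inj_uniq ?iota_uniq// => i j /eqP.
  by rewrite eqr_nat => /eqP[].
Qed.

(** With t = 1/s, the matrix is a nonzero multiple of [- K - s%:M], invertible when s is not an
    eigenvalue of [- K]. *)
Lemma exists_pos_unitmx_addZ (n : nat) (K : 'M[F]_n) :
  exists2 t : F, 0 < t & 1%:M + t *: K \in unitmx.
Proof.
have [s s0 rs] := exists_pos_nonroot (monic_neq0 (char_poly_monic (- K))).
exists s^-1; first by rewrite invr_gt0.
have -> : 1%:M + s^-1 *: K = - s^-1 *: (- K - s%:M).
  rewrite scalerBr scaleNr scalerN opprK addrC scale_scalar_mx mulNr mulVf ?gt_eqF//.
  by rewrite raddfN opprK.
rewrite unitmxZ ?unitfE ?oppr_eq0 ?invr_eq0 ?gt_eqF//.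
rewrite -row_free_unit -kermx_eq0.
by move: rs; rewrite -eigenvalue_root_char /eigenvalue negbK.
Qed.

(* If [L1 *m A *m U1 = 1%:M], bordering [L1] and [U1] with [xi] and [eta] gives
   L (A + t B) U = [1 + t a, t b; t c, t beta] with beta != 0, invertible for
   some t > 0. *)
Lemma exists_mxrank_increase (m n : nat) (A B : 'M[F]_(m, n))
    (xi : 'rV[F]_m) (eta : 'cV[F]_n) :
  xi *m A = 0 -> A *m eta = 0 -> xi *m B *m eta != 0 ->
  exists t : F, (\rank A < \rank (A + t *: B)%R)%N.
Proof.
move=> xiA Aeta beta0.
have [L1 L1A] := row_fullP (col_base_full A).
have [U1 U1A] := row_freeP (row_base_free A).
have AE : L1 *m A *m U1 = 1%:M.
  transitivity (L1 *m (col_base A *m row_base A) *m U1).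
    by rewrite mulmx_base.
  by rewrite mulmxA L1A mul1mx U1A.
pose L := col_mx L1 xi; pose U := row_mx U1 eta.
pose a := L1 *m B *m U1; pose b := L1 *m B *m eta.
pose c := xi *m B *m U1; pose beta := xi *m B *m eta.
(* The factor t of the second block row is set aside: what remains is [N0 + t *: N1], where [N0] is
   block triangular and invertible. *)
pose N0 := block_mx 1%:M 0 c beta : 'M[F]_(\rank A + 1, \rank A + 1).
pose N1 := block_mx a b 0 0 : 'M[F]_(\rank A + 1, \rank A + 1).
have betau : beta \in unitmx.
  rewrite unitmxE det_mx11 unitfE; apply: contra beta0 => /eqP b0.
  by apply/eqP/matrixP => i j; rewrite !ord1 [LHS]b0 mxE.
have N0u : N0 \in unitmx.
  by rewrite unitmxE det_lblock det1 mul1r -unitmxE.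
have [t t0 tu] := exists_pos_unitmx_addZ (invmx N0 *m N1).
exists t.
have tN : N0 + t *: N1 \in unitmx.
  have -> : N0 + t *: N1 = N0 *m (1%:M + t *: (invmx N0 *m N1)).
    by rewrite mulmxDr mulmx1 -scalemxAr mulKVmx.
  by rewrite unitmx_mul N0u.
have ME : L *m (A + t *: B) *m U = block_mx 1%:M 0 0 t%:M *m (N0 + t *: N1).
  rewrite mul_col_mx mul_col_row /N0 /N1 scale_block_mx add_block_mx mulmx_block.
  rewrite !mul1mx !mul0mx !scaler0 !addr0 !add0r !mul_scalar_mx.
  congr block_mx; rewrite mulmxDr -scalemxAr mulmxDl -scalemxAl.
  - by rewrite AE.
  - by rewrite -[L1 *m A *m eta]mulmxA Aeta mulmx0 add0r.
  - by rewrite xiA mul0mx add0r.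
  - by rewrite xiA mul0mx add0r.
have Mu : L *m (A + t *: B) *m U \in unitmx.
  rewrite ME unitmx_mul tN andbT unitmxE det_ublock det1 mul1r det_scalar1.
  by rewrite unitfE gt_eqF.
(* The invertible product has order [\rank A + 1], and its rank is at most that of its middle
   factor. *)
rewrite -addn1 -[leqLHS](mxrank_unit Mu).
exact: leq_trans (mxrankM_maxl _ _) (mxrankM_maxr _ _).
Qed.

End rank_increase.

Section column_space.
Context {R : realType} {p : nat}.

Lemma mulmx_column_space (A : 'M[R]_p) (v : 'cV[R]_p) : A *m v \in column_space A.
Proof.
have -> : A *m v = \sum_j v j ord0 *: col j A.
  apply/colP => i; rewrite !mxE summxE; apply: eq_bigr => j _.
  by rewrite !mxE mulrC.
apply: memv_suml => j _; apply/memvZ/memv_span/mapP; exists j => //.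
by rewrite mem_enum.
Qed.

Lemma column_space_sub (A : 'M[R]_p) (E : {vspace 'cV[R]_p}) :
  (forall v : 'cV_p, A *m v \in E) -> (column_space A <= E)%VS.
Proof.
move=> AE; apply/span_subvP => _ /mapP[j _ ->].
by rewrite colE.
Qed.

(* A matrix of maximal rank in [V] works: were its column space smaller than
   [E], some nonzero [eta] of [E] would lie in its kernel, and adding some
   multiple of the [B] attached to [eta] would increase the rank. *)
Lemma exists_column_space (V : set 'M[R]_p) (E : {vspace 'cV[R]_p}) :
  V !=set0 -> (forall A B t, V A -> V B -> V (A + t *: B)) ->
  (forall A, V A -> A^T = A /\ forall v : 'cV_p, A *m v \in E) ->
  (forall eta : 'cV_p, eta \in E -> eta != 0 ->
     exists2 B, V B & dotv eta (B *m eta) != 0) ->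
  exists2 A, V A & column_space A = E.
Proof.
move=> [A0 VA0] Vlin VE VB.
pose rk n := `[< exists2 A, V A & \rank A = n >].
have [r /asboolP[A VA <-] rmax] : exists2 n, rk n & forall m, rk m -> (m <= n)%N.
  have ex : exists n, rk n by exists (\rank A0); apply/asboolP; exists A0.
  have ub n : rk n -> (n <= p)%N.
    by move=> /asboolP[A _ <-]; exact: rank_leq_row.
  by case: (ex_maxnP ex ub) => n; exists n.
exists A => //; have [AT AE] := VE _ VA.
apply: subv_anti; apply/andP; split; first exact: column_space_sub.
apply/subvP => v vE; set W := column_space A.
pose eta := v - orth_proj W *m v.
have WE : orth_proj W *m v \in E.
  by apply: (subvP (column_space_sub AE)); exact: orth_proj_in.
have etaE : eta \in E by rewrite rpredB.
have [/eqP|eta0] := boolP (eta == 0).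
  by move/subr0_eq => ->; exact: orth_proj_in.
(* For symmetric [A] the orthogonal complement of the column space is the kernel; symmetry also
   makes [eta^T] a left kernel vector below. *)
have Aeta : A *m eta = 0.
  apply/eqP; rewrite -dotv_eq0 dotv_mulmx AT dotv_orth_proj_sub//.
  exact: mulmx_column_space.
have [B VBB /eqP beta0] := VB _ etaE eta0.
have [|||t rt] := @exists_mxrank_increase _ _ _ A B eta^T eta.
- by rewrite -[A]AT -trmx_mul Aeta trmx0.
- exact: Aeta.
- by apply/eqP => /matrixP/(_ ord0 ord0); rewrite [RHS]mxE -mulmxA.
have /rmax : rk (\rank (A + t *: B)%R).
  by apply/asboolP; exists (A + t *: B) => //; exact: Vlin.
by rewrite leqNgt rt.
Qed.

End column_space.

(** * Second moments *)

Section moments.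
Context {R : realType} {p : nat}.
Implicit Types (a b v : 'cV[R]_p).

Lemma dotvC a b : dotv a b = dotv b a.
Proof. by rewrite !dotvE; apply: eq_bigr => i _; rewrite mulrC. Qed.

Lemma dotvZr (c : R) a b : dotv a (c *: b) = c * dotv a b.
Proof. by rewrite /dotv -scalemxAr !mxE. Qed.

Lemma dotv_deltal i v : dotv (delta_mx i ord0) v = v i ord0.
Proof.
rewrite dotvE (bigD1 i)//= big1 ?mxE ?eqxx ?mul1r ?addr0// => j ji.
by rewrite mxE (negbTE ji) mul0r.
Qed.

Lemma enorm_ge0 v : 0 <= enorm v.
Proof. exact: sqrtr_ge0. Qed.

Lemma normr_dotv_le a v : `|dotv a v| <= (\sum_i `|a i ord0|) * enorm v.
Proof.
rewrite dotvE (le_trans (ler_norm_sum _ _ _))// mulr_suml ler_sum// => i _.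
rewrite normrM ler_wpM2l// -ler_sqr ?nnegrE ?enorm_ge0//.
rewrite enorm2 dotvE real_normK ?num_real// (bigD1 i)//= -expr2 lerDl.
by rewrite sumr_ge0// => j _; rewrite -expr2 sqr_ge0.
Qed.

Lemma measurable_dotv a : measurable_fun setT (fun v => dotv a v).
Proof.
under eq_fun do rewrite dotvE.
apply: measurable_sum => i; apply: measurable_funM => //.
exact: measurable_mx_entry.
Qed.

Lemma measurable_mulmx_cV (n : nat) (A : 'M[R]_(n, p)) :
  measurable_fun setT (fun v => A *m v).
Proof.
apply/measurable_fun_mxP => i j; rewrite ord1.
rewrite (_ : (fun v => _) = (fun v => dotv (row i A)^T v)).
  exact: measurable_dotv.
apply/funext => v; rewrite mxE dotvE; apply: eq_bigr => k _.
by rewrite !mxE.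
Qed.

Lemma measurable_enorm2 : measurable_fun setT (fun v => enorm v ^+ 2).
Proof.
under eq_fun do rewrite enorm2 dotvE.
by apply: measurable_sum => i; apply: measurable_funM; exact: measurable_mx_entry.
Qed.

Context {d : measure_display} {T : measurableType d} (P : probability T R).
Implicit Types (Z : {RV P >-> 'cV[R]_p}) (k : T -> R).

(** Each linear form is bounded by a multiple of the Euclidean norm. The weight [k] will be either 1
    or psi(Y). *)
Lemma integrable_moment2 Z k a b : measurable_fun setT k ->
  P.-integrable setT (EFin \o (fun w => k w * enorm (Z w) ^+ 2)) ->
  P.-integrable setT (EFin \o (fun w => k w * (dotv a (Z w) * dotv b (Z w)))).
Proof.
move=> mk ik; pose K c : R := \sum_i `|(c : 'cV[R]_p) i ord0|.
have mdot c : measurable_fun setT (fun w => dotv c (Z w)).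
  exact: (measurableT_comp (measurable_dotv c)).
have iKk := integrableZl measurableT (K a * K b) ik.
apply: le_integrable iKk => //.
  apply/measurable_EFinP/measurable_funM => //; exact: measurable_funM.
move=> w _ /=; rewrite lee_fin !normrM.
have K0 c : 0 <= K c by apply: sumr_ge0.
rewrite (ger0_norm (K0 a)) (ger0_norm (K0 b)) [leRHS]mulrCA ler_wpM2l//.
rewrite !(ger0_norm (enorm_ge0 _)) mulrACA.
by rewrite ler_pM// normr_dotv_le.
Qed.

Lemma integrable_enorm2 Z : ('E_P[fun w => (enorm (Z w) ^+ 2)%R] < +oo)%E ->
  P.-integrable setT (EFin \o (fun w => enorm (Z w) ^+ 2)).
Proof.
rewrite unlock => Z2; apply/integrableP; split.
  exact/measurable_EFinP/(measurableT_comp measurable_enorm2).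
under eq_integral do rewrite /= ger0_norm ?sqr_ge0//.
exact: Z2.
Qed.

Lemma integrable_dotv2 Z a b : ('E_P[fun w => (enorm (Z w) ^+ 2)%R] < +oo)%E ->
  P.-integrable setT (EFin \o (fun w => dotv a (Z w) * dotv b (Z w))).
Proof.
move=> /integrable_enorm2 iZ.
have i1 : P.-integrable setT (EFin \o (fun w => cst 1 w * enorm (Z w) ^+ 2)).
  by apply: eq_integrable iZ => // w _ /=; rewrite mul1r.
apply: eq_integrable (integrable_moment2 a b _ i1) => // w _ /=.
by rewrite mul1r.
Qed.

Lemma integrable_dotv Z a : ('E_P[fun w => (enorm (Z w) ^+ 2)%R] < +oo)%E ->
  P.-integrable setT (EFin \o (fun w => dotv a (Z w))).
Proof.
move=> /(integrable_dotv2 a a) iZ.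
(* The first moment is dominated by 1 plus the second, integrable because [P] is finite. *)
have h (x : R) : 0 <= x -> x <= 1 + x ^+ 2.
  move=> x0; have [x1|x1] := leP x 1.
    by rewrite (le_trans x1)// lerDl sqr_ge0.
  by rewrite (le_trans (ler_peMr x0 (ltW x1)))// lerDr.
have i1 : P.-integrable setT (EFin \o (cst 1 : T -> R)).
  exact: finite_measure_integrable_cst.
apply: le_integrable (integrableD measurableT i1 iZ) => //.
  exact/measurable_EFinP/(measurableT_comp (measurable_dotv a)).
move=> w _ /=; rewrite lee_fin -expr2 [leRHS]ger0_norm ?addr_ge0 ?sqr_ge0//.
rewrite -[dotv a (Z w) ^+ 2]real_normK ?num_real//.
exact: h (normr_ge0 _).
Qed.

Lemma Rintegral_lincomb (n : nat) (c : 'I_n -> R) (U : 'I_n -> T -> R) :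
  (forall i, P.-integrable setT (EFin \o U i)) ->
  \int[P]_x (\sum_i c i * U i x) = \sum_i c i * \int[P]_x U i x.
Proof.
elim: n c U => [|n IH] c U iU.
  under eq_Rintegral do rewrite big_ord0.
  by rewrite big_ord0 Rintegral_cst// mul0r.
rewrite big_ord_recr/= -RintegralZl// -IH; last by move=> i; exact: iU.
rewrite -RintegralD//.
- by apply: eq_Rintegral => x _; rewrite big_ord_recr.
- by apply: integrable_lincomb => i; exact: iU.
- exact: (integrableZl measurableT (c ord_max) (iU ord_max)).
Qed.

End moments.

(** * Conditional moments given the projection on the central subspace *)

Section conditional_moments.
Context {d : measure_display} {T : measurableType d} {R : realType}
  (P : probability T R) {p : nat}.
Implicit Types (Y : {RV P >-> R}) (Z S : {RV P >-> 'cV[R]_p})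
  (E : {vspace 'cV[R]_p}) (a b : 'cV[R]_p).

Lemma measurable_sigma_comp d' (S' : measurableType d') (h : {mfun T >-> S'})
    (F : S' -> R) : measurable_fun setT F ->
  measurable_fun setT (F \o h : g_sigma_algebra_preimageType h -> R).
Proof.
move=> mF _ B mB; exists (F @^-1` B); last by rewrite !setTI comp_preimage.
by rewrite -[X in measurable X]setTI; exact: mF.
Qed.

Lemma is_cexp_ae_left d' (S' : measurableType d') (h : {mfun T >-> S'})
    (U U' V : T -> R) :
  measurable_fun setT U -> measurable_fun setT U' ->
  {ae P, forall w, U w = U' w} ->
  is_cexp P (g_sigma_algebra_preimage h) U V ->
  is_cexp P (g_sigma_algebra_preimage h) U' V.
Proof.
move=> mU mU' UU' [sV iV UV]; split=> // A sA; rewrite UV//.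
by apply: ae_eq_integral_EFin => //; exact: sigma_algebra_preimage_measurable sA.
Qed.

(** Puts a vanishing conditional expectation in the integral form to which conditional independence
    applies. *)
Lemma is_cexp_ae0 d' (S' : measurableType d') (h : {mfun T >-> S'})
    (U V : T -> R) : is_cexp P (g_sigma_algebra_preimage h) U V ->
  {ae P, forall w, V w = 0} ->
  forall C, g_sigma_algebra_preimage h C -> (\int[P]_(w in C) (U w)%:E = 0)%E.
Proof.
move=> UV V0 C sC; have mC := sigma_algebra_preimage_measurable sC.
have mV := measurable_sigma_algebra_preimage (is_cexp_measurable UV).
case: UV => _ _ <-//.
rewrite (ae_eq_integral_EFin (V := cst 0) mC mV _ V0)//.
exact: integral0.
Qed.

Lemma is_cexp_dotv d' (S' : measurableType d') (h : {mfun T >-> S'}) Z a :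
  ('E_P[fun w => (enorm (Z w) ^+ 2)%R] < +oo)%E ->
  is_cexp P (g_sigma_algebra_preimage h) (fun w => dotv a (Z w))
    (fun w => dotv a (cexp_cV P (g_sigma_algebra_preimage h) Z w)).
Proof.
move=> Z2.
have iZ i : P.-integrable setT (EFin \o (fun w => Z w i ord0)).
  apply: eq_integrable (integrable_dotv (delta_mx i ord0) Z2) => // w _ /=.
  by rewrite dotv_deltal.
have := is_cexp_sum (fun i => a i ord0) iZ (fun i => cexpP h (iZ i)).
rewrite [X in is_cexp _ _ X _ -> _](_ : _ = (fun w => dotv a (Z w))); last first.
  by apply/funext => w; rewrite dotvE.
rewrite [X in is_cexp _ _ _ X -> _](_ : _ = (fun w =>
  dotv a (cexp_cV P (g_sigma_algebra_preimage h) Z w)))//.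
by apply/funext => w; rewrite dotvE; apply: eq_bigr => i _; rewrite mxE.
Qed.

Section fixed_projection.
Context {E : {vspace 'cV[R]_p}} {Z S : {RV P >-> 'cV[R]_p}}.
Let Pc := orth_proj E.
Let Qc := 1%:M - Pc.
Local Notation sigS := (g_sigma_algebra_preimage S).

Lemma comp_orth_projT : Qc^T = Qc.
Proof. by rewrite /Qc raddfB/= trmx1 orth_projT. Qed.

Lemma integral_linearity (Z2 : ('E_P[fun w => (enorm (Z w) ^+ 2)%R] < +oo)%E)
    (lin : {ae P, forall w, Qc *m cexp_cV P sigS Z w = 0}) a C :
  sigS C -> (\int[P]_(w in C) (dotv (Qc *m a) (Z w))%:E = 0)%E.
Proof.
apply: (is_cexp_ae0 (is_cexp_dotv S (Qc *m a) Z2)).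
apply: filterS lin => w e0.
by rewrite -[X in X *m a]comp_orth_projT -dotv_mulmx e0 /dotv mulmx0 mxE.
Qed.

(** The first factor is a function of [S], as is the indicator of [C]; both are pulled out, and the
    linearity condition disposes of the second factor. *)
Lemma integral_cross (Z2 : ('E_P[fun w => (enorm (Z w) ^+ 2)%R] < +oo)%E)
    (SE : forall w, S w = Pc *m Z w)
    (lin : {ae P, forall w, Qc *m cexp_cV P sigS Z w = 0}) a b C :
  sigS C ->
  (\int[P]_(w in C) (dotv (Pc *m a) (Z w) * dotv (Qc *m b) (Z w))%:E = 0)%E.
Proof.
move=> sC; have mC := sigma_algebra_preimage_measurable sC.
have SE' w : dotv (Pc *m a) (Z w) = dotv a (S w).
  by rewrite SE dotv_mulmx orth_projT.
have mH : measurable_fun setT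
    ((fun w => \1_C w * dotv (Pc *m a) (Z w)) : g_sigma_algebra_preimageType S -> R).
  apply: measurable_funM; first exact: measurable_indic.
  under eq_fun do rewrite SE'.
  exact: (measurable_sigma_comp (measurable_dotv a)).
rewrite -integralM_indic.
under eq_integral do rewrite mulrC mulrA.
apply: (integral_pull_out (G := sigS) _ _ (integrable_dotv (Qc *m b) Z2)).
- exact/sigma_algebra_preimage_funP/mH.
- exact: sigma_algebra_preimage_measurable.
- exact: integral_linearity.
- exact: measurable_sigma_algebra_preimage mH.
- have := @integrableM_bounded _ _ _ P \1_C _ _ _
    (integrable_dotv2 (Pc *m a) (Qc *m b) Z2).
  move=> /(_ (measurable_indic mC)); rewrite (_ : (fun x => _) =
    fun w => \1_C w * dotv (Pc *m a) (Z w) * dotv (Qc *m b) (Z w)).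
    apply; exists 1 => w; rewrite indicE; case: (_ \in _);
    by rewrite ?normr1 ?normr0.
  by apply/funext => w; rewrite mulrA.
Qed.

(** Given [S], the matrix of second moments of QZ is [lam] times Q, whose trace is (p - d) [lam].
    Subtracting the right multiple of the trace eliminates [lam]. *)
Lemma integral_diagonal (Z2 : ('E_P[fun w => (enorm (Z w) ^+ 2)%R] < +oo)%E)
    (SE : forall w, S w = Pc *m Z w) (dE : (\dim E < p)%N)
    (lin : {ae P, forall w, Qc *m cexp_cV P sigS Z w = 0})
    (lam : T -> R)
    (diag : {ae P, forall w, cvar_cV P sigS Z w = lam w *: Qc}) i j C :
  sigS C ->
  (\int[P]_(w in C) ((Qc *m Z w) i ord0 * (Qc *m Z w) j ord0
     - Qc i j / (p - \dim E)%:R * enorm (Qc *m Z w) ^+ 2)%:E = 0)%E.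
Proof.
set e := cexp_cV P sigS Z.
(* By the linearity condition E[Z | S] has no Q component, and its P component is PZ because that is
   a function of [S]. Thus Z - E[Z | S] = QZ almost surely, and the conditional variance is a
   conditional second moment of QZ. *)
have eE k : {ae P, forall w, (Z w - e w) k ord0 = (Qc *m Z w) k ord0}.
  have PZ1 : is_cexp P sigS (fun w => dotv (Pc *m delta_mx k ord0) (Z w))
      (fun w => dotv (Pc *m delta_mx k ord0) (Z w)).
    apply: is_cexp_id; first exact: integrable_dotv.
    rewrite (_ : (fun w => _) = (fun w => dotv (delta_mx k ord0) (S w))).
      exact: (measurable_sigma_comp (measurable_dotv _)).
    by apply/funext => w; rewrite SE dotv_mulmx orth_projT.
  have PZ2 := is_cexp_dotv S (Pc *m delta_mx k ord0) Z2.
  apply: filterS2 lin (is_cexp_unique PZ1 PZ2) => w Qe.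
  rewrite -[X in X *m _]orth_projT -!dotv_mulmx !dotv_deltal => Pe.
  have -> : e w = Pc *m e w.
    by apply/eqP; rewrite -subr_eq0 -{1}[e w]mul1mx -mulmxBl Qe.
  rewrite /Qc mulmxBl mul1mx [LHS]mxE [RHS]mxE; congr (_ + _).
  by rewrite [LHS]mxE [RHS]mxE Pe.
pose U k l w := (Z w - e w) k ord0 * (Z w - e w) l ord0.
pose U' k l w := (Qc *m Z w) k ord0 * (Qc *m Z w) l ord0.
have mZ k : measurable_fun setT (fun w => Z w k ord0).
  exact: (measurableT_comp (measurable_mx_entry k ord0)).
have mZe k : measurable_fun setT (fun w => (Z w - e w) k ord0).
  under eq_fun do rewrite !mxE; apply: measurable_funB => //.
  have iZ : P.-integrable setT (EFin \o (fun w => Z w k ord0)).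
    apply: eq_integrable (integrable_dotv (delta_mx k ord0) Z2) => // w _ /=.
    by rewrite dotv_deltal.
  exact: measurable_sigma_algebra_preimage (is_cexp_measurable (cexpP S iZ)).
have U'E k l w : U' k l w = dotv (Qc *m delta_mx k ord0) (Z w) *
    dotv (Qc *m delta_mx l ord0) (Z w).
  rewrite /U' -!(dotv_deltal _ (Qc *m Z w)).
  by rewrite !(dotv_mulmx _ _ Qc) comp_orth_projT.
have iU' k l : P.-integrable setT (EFin \o U' k l).
  apply: eq_integrable (integrable_dotv2 (Qc *m delta_mx k ord0)
    (Qc *m delta_mx l ord0) Z2) => // w _ /=.
  by rewrite U'E.
have mU k l : measurable_fun setT (U k l) by exact: measurable_funM.
have mU' k l : measurable_fun setT (U' k l).
  exact/measurable_EFinP/(measurable_int _ (iU' k l)).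
have UU' k l : {ae P, forall w, U k l w = U' k l w}.
  by apply: filterS2 (eE k) (eE l) => w ek el; rewrite /U ek el.
have iU k l : P.-integrable setT (EFin \o U k l).
  apply: ae_eq_integrable (iU' k l) => //.
  by apply: filterS (UU' k l) => w ->.
pose v k l w := cvar_cV P sigS Z w k l.
have UV k l : is_cexp P sigS (U' k l) (v k l).
  apply: is_cexp_ae_left (UU' k l) _ => //.
  rewrite (_ : v k l = cexp P sigS (U k l)); first exact: cexpP.
  by apply/funext => w; rewrite /v mxE.
have sU : is_cexp P sigS (fun w => \sum_k 1 * U' k k w)
    (fun w => \sum_k 1 * v k k w).
  exact: (is_cexp_sum (fun=> 1) (fun k => iU' k k) (fun k => UV k k)).
have isU : P.-integrable setT (EFin \o (fun w => \sum_k 1 * U' k k w)).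
  exact: (integrable_lincomb (fun=> 1) (fun k => iU' k k)).
have := is_cexpZD 1 (- (Qc i j / (p - \dim E)%:R)) (iU' i j) isU (UV i j) sU.
move=> /is_cexp_ae0 + sC => /(_ _ _ sC) H.
rewrite -[RHS]H.
  apply: eq_integral => w _; congr EFin; rewrite mul1r mulNr; congr (_ - _ * _).
  by rewrite enorm2 dotvE; apply: eq_bigr => k _; rewrite mul1r.
have trQ : \tr Qc = (p - \dim E)%:R.
  by rewrite raddfB/= mxtrace1 mxtrace_orth_proj natrB// ltnW.
apply: filterS diag => w vE.
have {}vE k l : v k l w = lam w * Qc k l by rewrite /v vE mxE.
under eq_bigr do rewrite mul1r vE.
rewrite vE mul1r -mulr_sumr -/(\tr Qc) trQ mulNr.
(* The division is by p - d, nonzero since d < p. *)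
rewrite [lam w * _%:R]mulrC mulrA divfK ?pnatr_eq0 -?lt0n ?subn_gt0//.
by rewrite mulrC subrr.
Qed.

End fixed_projection.
End conditional_moments.

(** * Psi matrices as bilinear forms and their range *)

Section psi_matrices.
Context {d : measure_display} {T : measurableType d} {R : realType}
  {P : probability T R} {p : nat} {Y : {RV P >-> R}} {Z : {RV P >-> 'cV[R]_p}}
  {E : {vspace 'cV[R]_p}}.
Implicit Types (psi phi : R -> R) (a b : 'cV[R]_p).
Let Pc := orth_proj E.
Let Qc := 1%:M - Pc.

Definition moment_weight psi := measurable_fun setT psi /\
  P.-integrable setT (EFin \o (fun w => psi (Y w) * enorm (Z w) ^+ 2)).

Lemma integrable_weight2 psi a b : moment_weight psi ->
  P.-integrable setT (EFin \o (fun w => psi (Y w) * (dotv a (Z w) * dotv b (Z w)))).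
Proof.
by move=> [m i]; apply: integrable_moment2 => //; exact: measurableT_comp m _.
Qed.

Lemma psi_matrix_entry psi i j : psi_matrix P Y Z psi i j =
  \int[P]_w (psi (Y w) * (dotv (delta_mx i ord0) (Z w) * dotv (delta_mx j ord0) (Z w))).
Proof.
rewrite mxE unlock /Rintegral; congr fine; apply: eq_integral => w _.
by rewrite !dotv_deltal mxE big_ord1 mxE mulrC.
Qed.

Lemma dotv_psi_matrix psi a b : moment_weight psi ->
  dotv a (psi_matrix P Y Z psi *m b) =
  \int[P]_w (psi (Y w) * (dotv a (Z w) * dotv b (Z w))).
Proof.
move=> mw.
transitivity (\int[P]_w \sum_i a i ord0 * (\sum_j b j ord0 * (psi (Y w) *
    (dotv (delta_mx i ord0) (Z w) * dotv (delta_mx j ord0) (Z w))))).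
  have iw i j := integrable_weight2 (delta_mx i ord0) (delta_mx j ord0) mw.
  rewrite Rintegral_lincomb => [|i]; last exact: integrable_lincomb.
  rewrite dotvE; apply: eq_bigr => i _; rewrite Rintegral_lincomb// mxE.
  by congr (_ * _); apply: eq_bigr => j _; rewrite psi_matrix_entry mulrC.
apply: eq_Rintegral => w _; rewrite (dotvE a) (dotvE b).
rewrite mulr_suml mulr_sumr; apply: eq_bigr => i _.
rewrite !mulr_sumr; apply: eq_bigr => j _; rewrite !dotv_deltal.
rewrite mulrA mulrCA; congr (_ * _).
by rewrite -!mulrA; congr (_ * _); rewrite mulrCA.
Qed.

Lemma psi_matrixT psi : (psi_matrix P Y Z psi)^T = psi_matrix P Y Z psi.
Proof.
apply/matrixP => i j; rewrite mxE !psi_matrix_entry.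
by apply: eq_Rintegral => w _; rewrite [dotv _ _ * dotv _ _]mulrC.
Qed.

Lemma enorm2_mulmx (A : 'M[R]_p) v : enorm (A *m v) ^+ 2 =
  \sum_k 1 * (dotv (A^T *m delta_mx k ord0) v * dotv (A^T *m delta_mx k ord0) v).
Proof.
rewrite enorm2 dotvE; apply: eq_bigr => k _.
by rewrite mul1r -dotv_mulmx dotv_deltal.
Qed.

Lemma integrable_weight_enorm2 psi (A : 'M[R]_p) : moment_weight psi ->
  P.-integrable setT (EFin \o (fun w => psi (Y w) * enorm (A *m Z w) ^+ 2)).
Proof.
move=> mw.
have := integrable_lincomb (fun=> 1) (fun k => integrable_weight2
  (A^T *m delta_mx k ord0) (A^T *m delta_mx k ord0) mw).
apply: eq_integrable => // w _ /=; congr EFin.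
rewrite enorm2_mulmx mulr_sumr; apply: eq_bigr => k _.
by rewrite !mul1r.
Qed.

Lemma lambda_starE psi : lambda_star P Y Z E psi =
  (\int[P]_w (psi (Y w) * enorm (Qc *m Z w) ^+ 2)) / (p - \dim E)%:R.
Proof.
rewrite /lambda_star unlock; congr (fine _ / _).
by apply: eq_integral => w _; rewrite mulrC.
Qed.

(** The matrix A_psi, of which [psi_space] is the column space. *)
Definition centered_psi_matrix psi :=
  psi_matrix P Y Z psi - (lambda_star P Y Z E psi)%:M.

Lemma centered_psi_matrixT psi :
  (centered_psi_matrix psi)^T = centered_psi_matrix psi.
Proof. by rewrite /centered_psi_matrix raddfB/= psi_matrixT tr_scalar_mx. Qed.

(** This provides the closure under [A + t *: B] demanded by [exists_column_space]. *)
Lemma centered_psi_matrixDZ psi phi t : moment_weight psi -> moment_weight phi ->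
  centered_psi_matrix (fun y => psi y + t * phi y) =
  centered_psi_matrix psi + t *: centered_psi_matrix phi.
Proof.
move=> w1 w2.
have lin (G : T -> R) : P.-integrable setT (EFin \o (fun w => psi (Y w) * G w)) ->
    P.-integrable setT (EFin \o (fun w => phi (Y w) * G w)) ->
    \int[P]_w ((psi (Y w) + t * phi (Y w)) * G w) =
    \int[P]_w (psi (Y w) * G w) + t * \int[P]_w (phi (Y w) * G w).
  move=> i1 i2; rewrite -RintegralZl// -RintegralD//.
    by apply: eq_Rintegral => w _; rewrite mulrDl mulrA.
  exact: (integrableZl measurableT t i2).
have lE : lambda_star P Y Z E (fun y => psi y + t * phi y) =
    lambda_star P Y Z E psi + t * lambda_star P Y Z E phi.
  rewrite !lambda_starE lin; [|exact: integrable_weight_enorm2..].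
  by rewrite mulrDl mulrA.
have mE : psi_matrix P Y Z (fun y => psi y + t * phi y) =
    psi_matrix P Y Z psi + t *: psi_matrix P Y Z phi.
  apply/matrixP => i j; rewrite [RHS]mxE [X in _ = _ + X]mxE !psi_matrix_entry.
  by rewrite lin//; exact: integrable_weight2.
rewrite /centered_psi_matrix mE lE raddfD/= scalerBr scale_scalar_mx.
by rewrite opprD addrACA.
Qed.

Context {S : {RV P >-> 'cV[R]_p}}.
Local Notation sigS := (g_sigma_algebra_preimage S).

(** Conditional independence carries zero integrals over the sigma-algebra of [S] to that of [Y];
    then psi(Y) is pulled out. *)
Lemma weighted_integral0 psi (F : 'cV[R]_p -> R) :
  cond_indep P (g_sigma_algebra_preimage Y) (g_sigma_algebra_preimage Z) sigS ->
  measurable_fun setT F -> P.-integrable setT (EFin \o (F \o Z)) ->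
  (forall C, sigS C -> \int[P]_(w in C) (F (Z w))%:E = 0)%E ->
  measurable_fun setT psi ->
  P.-integrable setT (EFin \o (fun w => psi (Y w) * F (Z w))) ->
  \int[P]_w (psi (Y w) * F (Z w)) = 0.
Proof.
move=> CI mF iF F0 mpsi ipsi.
have FY := cond_indep_integral0 CI (measurable_sigma_comp mF) iF F0.
rewrite /Rintegral (integral_pull_out (G := g_sigma_algebra_preimage Y)
  (H := psi \o Y) _ _ iF FY)//.
- exact/sigma_algebra_preimage_funP/measurable_sigma_comp.
- exact: sigma_algebra_preimage_measurable.
- exact: measurableT_comp mpsi _.
Qed.

Lemma orth_proj_centered_psi_matrix psi
    (Z2 : ('E_P[fun w => (enorm (Z w) ^+ 2)%R] < +oo)%E)
    (SE : forall w, S w = Pc *m Z w) (dE : (\dim E < p)%N)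
    (CI : cond_indep P (g_sigma_algebra_preimage Y) (g_sigma_algebra_preimage Z) sigS)
    (lin : {ae P, forall w, Qc *m cexp_cV P sigS Z w = 0})
    (lam : T -> R)
    (diag : {ae P, forall w, cvar_cV P sigS Z w = lam w *: Qc}) v :
  moment_weight psi -> centered_psi_matrix psi *m v \in E.
Proof.
move=> mw; have [mpsi ipsi] := mw; set M := psi_matrix P Y Z psi.
have QT : Qc^T = Qc by exact: comp_orth_projT.
have mdot a : measurable_fun setT (fun v => dotv a v) by exact: measurable_dotv.
have ME a b := dotv_psi_matrix a b mw.
have entry (B : 'M[R]_p) i j :
    B i j = dotv (delta_mx i ord0) (B *m delta_mx j ord0).
  by rewrite dotv_deltal -colE mxE.
have PMQ : Pc *m M *m Qc = 0.
  apply/matrixP => i j; rewrite entry [RHS]mxE -!mulmxA dotv_mulmx orth_projT ME.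
  apply: (weighted_integral0 (F := fun v => dotv (Pc *m delta_mx i ord0) v *
    dotv (Qc *m delta_mx j ord0) v)) => //.
  - exact: measurable_funM.
  - exact: integrable_dotv2.
  - exact: integral_cross.
  - exact: integrable_weight2.
have QMQ : Qc *m M *m Qc = lambda_star P Y Z E psi *: Qc.
  apply/matrixP => i j; rewrite entry -!mulmxA dotv_mulmx QT ME [RHS]mxE.
  have iQ := integrable_weight2 (Qc *m delta_mx i ord0) (Qc *m delta_mx j ord0) mw.
  have inorm := integrable_weight_enorm2 Qc mw.
  have QE k v' : (Qc *m v') k ord0 = dotv (Qc *m delta_mx k ord0) v'.
    by rewrite -(dotv_deltal k (Qc *m v')) dotv_mulmx QT.
  pose F v' := (Qc *m v') i ord0 * (Qc *m v') j ord0
     - Qc i j / (p - \dim E)%:R * enorm (Qc *m v') ^+ 2.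
  have mnorm : measurable_fun setT (fun v' : 'cV[R]_p => enorm (Qc *m v') ^+ 2).
    exact: (measurableT_comp measurable_enorm2 (measurable_mulmx_cV Qc)).
  have mF : measurable_fun setT F.
    apply: measurable_funB; last exact: measurable_funM.
    by under eq_fun do rewrite !QE; exact: measurable_funM.
  (* The constant weight gives integrability of [F \o Z], the weight psi that of the product. *)
  have i1 : moment_weight (cst 1).
    split; first exact: measurable_cst.
    by apply: eq_integrable (integrable_enorm2 Z2) => // w _ /=; rewrite mul1r.
  have iZ phi : moment_weight phi ->
      P.-integrable setT (EFin \o (fun w => phi (Y w) * F (Z w))).
    move=> wphi.
    have j1 := integrable_weight2 (Qc *m delta_mx i ord0) (Qc *m delta_mx j ord0) wphi.
    have j2 := integrableZl measurableT (Qc i j / (p - \dim E)%:R)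
      (integrable_weight_enorm2 Qc wphi).
    apply: eq_integrable (integrableB measurableT j1 j2) => // w _ /=.
    by rewrite /F !QE mulrBr (mulrCA (phi (Y w)) (Qc i j / _)).
  have : \int[P]_w (psi (Y w) * F (Z w)) = 0.
    apply: weighted_integral0 => //; last exact: iZ.
    - by apply: eq_integrable (iZ _ i1) => // w _ /=; rewrite mul1r.
    - by move=> C; exact: integral_diagonal diag _ _ _.
  have -> : \int[P]_w (psi (Y w) * F (Z w)) =
    \int[P]_w (psi (Y w) * (dotv (Qc *m delta_mx i ord0) (Z w) *
       dotv (Qc *m delta_mx j ord0) (Z w))) -
    Qc i j / (p - \dim E)%:R * \int[P]_w (psi (Y w) * enorm (Qc *m Z w) ^+ 2).
    rewrite -RintegralZl// -RintegralB//.
      by apply: eq_Rintegral => w _; rewrite /F !QE mulrBr (mulrCA (psi (Y w)) (Qc i j / _)).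
    exact: (integrableZl measurableT _ inorm).
  move/subr0_eq => ->; rewrite lambda_starE.
  by rewrite mulrAC -mulrA mulrC.
(* By the value of QMQ this product is QM - QMQ = QMP, the transpose of PMQ. *)
have QA : Qc *m centered_psi_matrix psi = 0.
  rewrite /centered_psi_matrix mulmxBr -/M mul_mx_scalar -QMQ.
  rewrite -{1}[Qc *m M]mulmx1 -mulmxBr (_ : 1%:M - Qc = Pc); last first.
    by rewrite opprB addrC subrK.
  by apply: trmx_inj; rewrite !trmx_mul orth_projT psi_matrixT QT mulmxA PMQ trmx0.
have -> : centered_psi_matrix psi *m v = Pc *m (centered_psi_matrix psi *m v).
  apply/eqP; rewrite -subr_eq0 -{1}[centered_psi_matrix psi *m v]mul1mx -mulmxBl.
  by rewrite mulmxA QA mul0mx.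
exact: orth_proj_in.
Qed.

End psi_matrices.

(** * Density in the weighted L1 space *)

Section weighted_L1_density.
Context {d : measure_display} {T : measurableType d} {R : realType}
  {P : probability T R} {Y : {RV P >-> R}}.
Implicit Types (U W : T -> R) (u : R -> R).

Lemma regressionP U : P.-integrable setT (EFin \o U) ->
  is_regression Y U (regression Y U).
Proof.
move=> /(exists_regression Y) iU.
exact: (@xgetPex _ (cst 0 : R -> R) [set h | is_regression Y U h]).
Qed.

(** Change of variables to the law of [Y], then u(Y) is pulled out. The regression function is
    nonnegative only almost everywhere, so its positive part takes its place. *)
Lemma integral_regression U u : P.-integrable setT (EFin \o U) ->
  (forall w, 0 <= U w) -> measurable_fun setT u -> (forall y, 0 <= u y) ->
  (\int[distribution P Y]_y (u y * regression Y U y)%:E =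
   \int[P]_w (u (Y w) * U w)%:E)%E.
Proof.
move=> iU U0 mu u0; have [mh ih hU] := regressionP iU.
have mU : measurable_fun setT U by exact/measurable_EFinP/(measurable_int _ iU).
set h := regression Y U in mh ih hU *.
have h0 : {ae distribution P Y, forall y, 0 <= h y}.
  apply: (ae_ge0_integral (G := measurable)) => // [B mB|A mA].
    by rewrite -[_ @^-1` _]setTI; exact: mh.
  by rewrite hU// integral_ge0// => w _; rewrite lee_fin.
have mhp := measurable_funrpos mh.
have hp : {ae distribution P Y, forall y, h y = h^\+ y}.
  by apply: filterS h0 => y hy; rewrite /funrpos (max_idPl hy).
have mYhp : measurable_fun setT (h^\+ \o Y) by exact: measurableT_comp.
rewrite (ae_eq_integral_EFin (V := fun y => u y * h^\+ y))//; last 3 first.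
- exact: measurable_funM.
- exact: measurable_funM.
- by apply: filterS hp => y <-.
rewrite ge0_integral_distribution//; last 2 first.
- exact/measurable_EFinP/measurable_funM.
- by move=> y; rewrite lee_fin mulr_ge0.
have ihp := ae_eq_integrable mhp hp ih.
have hpU B : measurable B -> (\int[distribution P Y]_(y in B) (h^\+ y)%:E
    = \int[P]_(w in Y @^-1` B) (U w)%:E)%E.
  move=> mB; rewrite -hU//; apply: ae_eq_integral_EFin => //.
  by apply: filterS hp => y <-.
have [shp _ hpE] := is_cexp_comp mhp ihp hpU.
apply: (ge0_integral_pull_out (G := g_sigma_algebra_preimage Y)
  (H := u \o Y) (U := h^\+ \o Y)) => //.
- exact/sigma_algebra_preimage_funP/measurable_sigma_comp.
- exact: (measurableT_comp mu).
- by move=> w /=.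
- by move=> w /=.
Qed.

(** The weight being E[U | Y = y], the weighted norm of u is E[|u(Y)| U], which brings the space
    back to [P]. *)
Lemma weighted_L1_integrable U u : P.-integrable setT (EFin \o U) ->
  (forall w, 0 <= U w) ->
  weighted_L1 (regression Y U) (distribution P Y) u <->
  measurable_fun setT u /\
  P.-integrable setT (EFin \o (fun w => u (Y w) * U w)).
Proof.
move=> iU U0.
have mU : measurable_fun setT U by exact/measurable_EFinP/(measurable_int _ iU).
have key : measurable_fun setT u ->
    (\int[distribution P Y]_y (`|u y| * regression Y U y)%:E < +oo)%E <->
    P.-integrable setT (EFin \o (fun w => u (Y w) * U w)).
  move=> mu; rewrite (integral_regression iU U0 (u := fun y => `|u y|))//.
    have mf : measurable_fun setT (EFin \o (fun w => u (Y w) * U w)).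
      apply/measurable_EFinP/measurable_funM => //.
      exact: (measurableT_comp mu).
    have -> : (\int[P]_w (`|u (Y w)| * U w)%:E =
        \int[P]_w `|(u (Y w) * U w)%:E|)%E.
      by apply: eq_integral => w _ /=; rewrite normrM (ger0_norm (U0 w)).
    by split=> [h|/integrableP[]//]; apply/integrableP.
  exact: measurableT_comp.
by split=> -[mu /(key mu)].
Qed.

Lemma lin_span_integrable U Psi v : P.-integrable setT (EFin \o U) ->
  (forall w, 0 <= U w) ->
  Psi `<=` weighted_L1 (regression Y U) (distribution P Y) ->
  lin_span Psi v -> measurable_fun setT v /\
    P.-integrable setT (EFin \o (fun w => v (Y w) * U w)).
Proof.
move=> iU U0 PsiL [n [c [f [Psif ->]]]].
have fL i := (weighted_L1_integrable _ iU U0).1 (PsiL _ (Psif i)).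
split.
  by apply: measurable_sum => i; apply: measurable_funM => //; case: (fL i).
apply: eq_integrable (integrable_lincomb c (fun i => (fL i).2)) => // w _ /=.
by rewrite mulr_suml; congr EFin; apply: eq_bigr => i _; rewrite mulrA.
Qed.

(** The bound on [W] makes v -> E[v(Y) W] continuous for the weighted norm. It vanishes on a dense
    span, hence on indicators. *)
Lemma total_integral0 U W (K : R) Psi :
  P.-integrable setT (EFin \o U) -> (forall w, 0 <= U w) ->
  measurable_fun setT W -> (forall w, `|W w| <= K * U w) ->
  total_in_L1 (regression Y U) (distribution P Y) Psi ->
  (forall v, lin_span Psi v -> \int[P]_w (v (Y w) * W w) = 0) ->
  forall B, measurable B -> (\int[P]_(w in Y @^-1` B) (W w)%:E = 0)%E.
Proof.
move=> iU U0 mW WU [PsiL dense] spanW B mB.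
have mU : measurable_fun setT U by exact/measurable_EFinP/(measurable_int _ iU).
have iuW u : measurable_fun setT u ->
    P.-integrable setT (EFin \o (fun w => u (Y w) * U w)) ->
    P.-integrable setT (EFin \o (fun w => u (Y w) * W w)).
  move=> mu iu; apply: le_integrable (integrableZl measurableT K iu) => //.
    apply/measurable_EFinP/measurable_funM => //; exact: (measurableT_comp mu).
  move=> w _ /=; rewrite lee_fin !normrM mulrCA ler_wpM2l//.
  by rewrite -normrM (le_trans (WU w))// ler_norm.
pose u : R -> R := \1_B.
have mu : measurable_fun setT u by exact: measurable_indic.
have iu : P.-integrable setT (EFin \o (fun w => u (Y w) * U w)).
  apply: integrableM_bounded => //; first exact: (measurableT_comp mu).
  by exists 1 => w; rewrite /u indicE; case: (_ \in _); rewrite ?normr1 ?normr0.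
have -> : (\int[P]_(w in Y @^-1` B) (W w)%:E = (\int[P]_w (u (Y w) * W w))%:E)%E.
  rewrite /Rintegral fineK; last exact: integrable_fin_num (iuW _ mu iu).
  rewrite -[LHS]integralM_indic; apply: eq_integral => w _.
  by rewrite mulrC /u !indicE.
congr EFin; apply/eqP; rewrite -normr_le0; apply/ler_addgt0Pl => e e0.
(* Approximating within [e / (|K| + 1)] bounds the integral by [e]; adding 1 keeps the divisor
   positive when [K] is 0. *)
have K0 : 0 < `|K| + 1 by rewrite ltr_pwDr.
have uL : weighted_L1 (regression Y U) (distribution P Y) u.
  exact/weighted_L1_integrable.
have [v vspan uv] := dense u uL (e / (`|K| + 1)) (divr_gt0 e0 K0).
have [mv iv] := lin_span_integrable iU U0 PsiL vspan.
have muv : measurable_fun setT (fun y => u y - v y) by exact: measurable_funB.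
have iuv : P.-integrable setT (EFin \o (fun w => (u (Y w) - v (Y w)) * U w)).
  apply: eq_integrable (integrableB measurableT iu iv) => // w _ /=.
  by rewrite -EFinB mulrBl.
have inuv : P.-integrable setT (EFin \o (fun w => `|u (Y w) - v (Y w)| * U w)).
  apply: eq_integrable (integrable_norm iuv) => // w _ /=.
  by rewrite normrM (ger0_norm (U0 w)).
have iuvW := iuW (fun y => u y - v y) muv iuv.
have uvE : \int[P]_w (`|u (Y w) - v (Y w)| * U w) < e / (`|K| + 1).
  rewrite -lte_fin /Rintegral fineK; last exact: integrable_fin_num inuv.
  have := integral_regression iU U0 (u := fun y => `|u y - v y|).
  by move=> <-//; exact: measurableT_comp.
have -> : \int[P]_w (u (Y w) * W w) = \int[P]_w ((u (Y w) - v (Y w)) * W w).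
  rewrite -[RHS]addr0 -(spanW _ vspan) -RintegralD//; last exact: iuW.
  by apply: eq_Rintegral => w _; rewrite mulrBl subrK.
rewrite addr0 (le_trans (le_normr_Rintegral _ _))//.
apply: (@le_trans _ _ (`|K| * \int[P]_w (`|u (Y w) - v (Y w)| * U w))).
  rewrite -RintegralZl//; apply: le_Rintegral => //.
  - exact: integrable_norm iuvW.
  - exact: (integrableZl measurableT _ inuv).
  - move=> w _ /=; rewrite normrM mulrCA ler_wpM2l//.
    by rewrite (le_trans (WU w))// ler_wpM2r// ler_norm.
rewrite (le_trans (ler_wpM2l (normr_ge0 K) (ltW uvE)))//.
by rewrite mulrCA ger_pMr// ler_pdivrMr// mul1r lerDl.
Qed.

End weighted_L1_density.

(** * From density to the equality of the two subspaces *)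

Section central_subspace.
Context {d : measure_display} {T : measurableType d} {R : realType}
  {P : probability T R} {p : nat}.

Lemma lin_span0 (Psi : set (R -> R)) : lin_span Psi (cst 0).
Proof.
exists 0%N, (fun=> 0), (fun=> cst 0); split; first by case.
by apply/funext => y; rewrite big_ord0.
Qed.

Lemma lin_spanDZ (Psi : set (R -> R)) u v t : lin_span Psi u -> lin_span Psi v ->
  lin_span Psi (fun y => u y + t * v y).
Proof.
move=> [n [c [f [Psif ->]]]] [m [c' [g [Psig ->]]]].
exists (n + m)%N.
exists (fun i => match fintype.split i with inl j => c j | inr k => t * c' k end).
exists (fun i => match fintype.split i with inl j => f j | inr k => g k end).
split; first by move=> i; case: fintype.split.
apply/funext => y; rewrite big_split_ord/=; congr (_ + _).
  by apply: eq_bigr => j _; rewrite (unsplitK (inl j)).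
rewrite mulr_sumr; apply: eq_bigr => k _.
by rewrite (unsplitK (inr k)) mulrA.
Qed.

Lemma enorm_mulmx_le (A : 'M[R]_p) :
  exists K : R, forall v : 'cV[R]_p, enorm (A *m v) ^+ 2 <= K * enorm v ^+ 2.
Proof.
pose K k := \sum_i `|(A^T *m delta_mx k ord0 : 'cV[R]_p) i ord0|.
exists (\sum_k K k ^+ 2) => v; rewrite enorm2_mulmx mulr_suml.
apply: ler_sum => k _; rewrite mul1r -expr2 -exprMn.
by rewrite -[leLHS]real_normK ?num_real// lerXn2r ?nnegrE ?normr_dotv_le//
  mulr_ge0 ?enorm_ge0// sumr_ge0.
Qed.

Lemma ae_probability1 (A : set T) : measurable A -> {ae P, forall w, A w} ->
  P A = 1%E.
Proof.
move=> mA [N [mN PN AN]].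
have PC : P (~` A) = 0%E.
  by apply: subset_measure0 PN => //; exact: measurableC.
by have := probability_setC P (measurableC mA); rewrite setCK PC sube0.
Qed.

Context {Y : {RV P >-> R}} {Z : {RV P >-> 'cV[R]_p}} {E : {vspace 'cV[R]_p}}.
Let Qc := 1%:M - orth_proj E.
Local Notation Apsi :=
  (centered_psi_matrix (P := P) (Y := Y) (Z := Z) (E := E)).
Local Notation sigY := (g_sigma_algebra_preimage Y).

(** By contraposition: if the form vanishes on the span, density gives [U1] and [U2] the same
    integrals over the sigma-algebra of [Y], so their conditional expectations agree with
    probability 1. *)
Lemma exists_nonzero_form Psi (eta : 'cV[R]_p)
    (Z2 : ('E_P[fun w => (enorm (Z w) ^+ 2)%R] < +oo)%E) :
  total_in_L1 (regression Y (fun w => enorm (Z w) ^+ 2)) (distribution P Y) Psi ->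
  enorm eta = 1 ->
  (P [set w | (cexp P sigY (fun w' => dotv eta (Z w') ^+ 2) w
      = cexp P sigY (fun w' => enorm (Qc *m Z w') ^+ 2 / (p - \dim E)%:R) w)%R]
      < 1)%E ->
  exists2 psi, lin_span Psi psi
    & dotv eta (Apsi psi *m eta) != 0.
Proof.
move=> tot eta1; apply: contraPP => nex.
have A0 psi : lin_span Psi psi ->
    dotv eta (Apsi psi *m eta) = 0.
  by move=> spsi; apply/eqP/negPn/negP => An0; apply: nex; exists psi.
have iZ := integrable_enorm2 Z2.
have Z0 w : 0 <= enorm (Z w) ^+ 2 by exact: sqr_ge0.
pose U1 w := dotv eta (Z w) ^+ 2.
pose U2 w := enorm (Qc *m Z w) ^+ 2 / (p - \dim E)%:R.
have mdot : measurable_fun setT (fun w => dotv eta (Z w)).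
  exact: (measurableT_comp (measurable_dotv eta)).
have mnorm : measurable_fun setT (fun w => enorm (Qc *m Z w) ^+ 2).
  have m1 := measurableT_comp measurable_enorm2 (measurable_mulmx_cV Qc).
  exact: (measurableT_comp m1).
have mU1 : measurable_fun setT U1 by exact: measurable_funM.
have mU2 : measurable_fun setT U2 by exact: measurable_funM.
have bound (U : T -> R) K : measurable_fun setT U ->
    (forall w, `|U w| <= K * enorm (Z w) ^+ 2) -> P.-integrable setT (EFin \o U).
  move=> mU UK; apply: le_integrable (integrableZl measurableT K iZ) => //.
    exact/measurable_EFinP.
  by move=> w _ /=; rewrite lee_fin (le_trans (UK w))// ler_norm.
pose K1 := (\sum_i `|eta i ord0|) ^+ 2.
have U1K w : `|U1 w| <= K1 * enorm (Z w) ^+ 2.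
  rewrite /U1 normrX -exprMn lerXn2r ?nnegrE ?normr_dotv_le//.
  by rewrite mulr_ge0 ?enorm_ge0// sumr_ge0.
have [K QK] := enorm_mulmx_le Qc.
have U2K w : `|U2 w| <= K / (p - \dim E)%:R * enorm (Z w) ^+ 2.
  rewrite /U2 ger0_norm ?divr_ge0 ?sqr_ge0//.
  by rewrite [leRHS]mulrAC ler_wpM2r// invr_ge0.
have iU1 := bound _ _ mU1 U1K; have iU2 := bound _ _ mU2 U2K.
have WK w : `|U1 w - U2 w| <= (K1 + K / (p - \dim E)%:R) * enorm (Z w) ^+ 2.
  by rewrite (le_trans (ler_normB _ _))// mulrDl lerD.
have spanW v : lin_span Psi v -> \int[P]_w (v (Y w) * (U1 w - U2 w)) = 0.
  move=> sv; rewrite -(A0 _ sv).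
  have mw : moment_weight v := lin_span_integrable iZ Z0 tot.1 sv.
  rewrite /centered_psi_matrix mulmxBl dotvBr (dotv_psi_matrix _ _ mw).
  (* As [eta] is a unit vector, the scalar part contributes exactly lambda*, the integral of psi(Y)
     [U2]. *)
  rewrite mul_scalar_mx dotvZr -enorm2 eta1 expr1n mulr1 lambda_starE.
  rewrite -RintegralZr//; last exact: integrable_weight_enorm2.
  rewrite -RintegralB//.
  - by apply: eq_Rintegral => w _; rewrite mulrBr /U1 /U2 -mulrA expr2.
  - exact: integrable_weight2.
  - have i3 := integrableZl measurableT (p - \dim E)%:R^-1
      (integrable_weight_enorm2 Qc mw).
    by apply: eq_integrable i3 => // w _ /=; rewrite -EFinM mulrC.
have mW : measurable_fun setT (fun w => U1 w - U2 w) by exact: measurable_funB.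
have W0 := total_integral0 iZ Z0 mW WK tot spanW.
have C1 := cexpP Y iU1; have C2 := cexpP Y iU2.
have C21 : is_cexp P sigY U2 (cexp P sigY U1).
  case: C1 => sV iV eV; split => // A sA; rewrite eV//.
  have mA := sigma_algebra_preimage_measurable sA.
  apply/(integralB_eq0 mA).
  - exact: integrableS iU1.
  - exact: integrableS iU2.
  - by case: sA => B mB <-; rewrite setTI; exact: W0.
have c12 := is_cexp_unique C21 C2.
rewrite -[X in P X]/[set w | cexp P sigY U1 w = cexp P sigY U2 w].
rewrite ae_probability1 ?ltxx//.
have m1 := measurable_sigma_algebra_preimage (is_cexp_measurable C1).
have m2 := measurable_sigma_algebra_preimage (is_cexp_measurable C2).
rewrite (_ : [set w | _] = (fun w => cexp P sigY U1 w - cexp P sigY U2 w) @^-1` [set 0]).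
  by rewrite -[X in measurable X]setTI; exact: (measurable_funB m1 m2).
by apply/seteqP; split=> w /=; [move=> ->; rewrite subrr|move/subr0_eq].
Qed.

Context {S : {RV P >-> 'cV[R]_p}}.
Local Notation sigS := (g_sigma_algebra_preimage S).

Lemma exists_psi_space Psi (lam : T -> R)
    (SE : forall w, S w = orth_proj E *m Z w) (dE : (\dim E < p)%N)
    (CI : cond_indep P sigY (g_sigma_algebra_preimage Z) sigS)
    (Z2 : ('E_P[fun w => (enorm (Z w) ^+ 2)%R] < +oo)%E)
    (lin : {ae P, forall w, Qc *m cexp_cV P sigS Z w = 0})
    (diag : {ae P, forall w, cvar_cV P sigS Z w = lam w *: Qc})
    (nondeg : forall eta : 'cV[R]_p, eta \in E -> enorm eta = 1 ->
      (P [set w | (cexp P sigY (fun w' => dotv eta (Z w') ^+ 2) w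
        = cexp P sigY (fun w' => enorm (Qc *m Z w') ^+ 2 / (p - \dim E)%:R) w)%R]
      < 1)%E) :
  total_in_L1 (regression Y (fun w => enorm (Z w) ^+ 2)) (distribution P Y) Psi ->
  exists2 psi, lin_span Psi psi & psi_space P Y Z E psi = E.
Proof.
move=> tot.
have iZ := integrable_enorm2 Z2.
have Z0 w : 0 <= enorm (Z w) ^+ 2 by exact: sqr_ge0.
have mw psi : lin_span Psi psi -> moment_weight (P := P) (Y := Y) (Z := Z) psi.
  exact: (lin_span_integrable iZ Z0 tot.1).
have [||||_ [psi spsi <-] AE] := @exists_column_space _ _
    [set Apsi psi
      | psi in lin_span Psi] E.
- by exists (Apsi (cst 0)); exists (cst 0) => //; exact: lin_span0.
- move=> _ _ t [psi spsi <-] [phi sphi <-].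
  exists (fun y => psi y + t * phi y); first exact: lin_spanDZ.
  by rewrite centered_psi_matrixDZ//; exact: mw.
- move=> _ [psi spsi <-]; split; first exact: centered_psi_matrixT.
  move=> v; exact: (orth_proj_centered_psi_matrix Z2 SE dE CI lin diag v (mw _ spsi)).
(* The nondegeneracy hypothesis concerns unit vectors, so [eta] is normalized; the form is
   homogeneous of degree 2, so its nonvanishing returns to [eta]. *)
- move=> eta etaE eta0; pose eta1 := (enorm eta)^-1 *: eta.
  have r0 : enorm eta != 0.
    by apply: contra eta0 => /eqP r0; rewrite -dotv_eq0 -enorm2 r0 expr0n.
  have e1 : enorm eta1 = 1.
    apply/eqP; rewrite -(@eqrXn2 _ 2) ?enorm_ge0// expr1n enorm2 /eta1.
    rewrite dotvZr dotvC dotvZr -enorm2 mulrA -expr2 -exprMn mulVf//.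
    by rewrite expr1n.
  have [psi spsi An0] := exists_nonzero_form Z2 tot e1 (nondeg _ (memvZ _ etaE) e1).
  exists (Apsi psi); first by exists psi.
  apply: contra An0 => /eqP A0.
  by rewrite /eta1 -scalemxAr dotvZr dotvC dotvZr (dotvC _ eta) A0 !mulr0.
by exists psi.
Qed.

End central_subspace.

Lemma measurable_standardized (d : measure_display) (T : measurableType d)
    (R : realType) (P : probability T R) (p : nat) (X : {RV P >-> 'cV[R]_p}) :
  measurable_fun setT (standardized P X).
Proof.
apply: (measurableT_comp (measurable_mulmx_cV _)).
apply/measurable_fun_mxP => i j; under eq_fun do rewrite !mxE.
apply: measurable_funB => //.
exact: (measurableT_comp (measurable_mx_entry i j)).
Qed.

Theorem theorem4p3 (R : realType) (disp : measure_display)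
    (T : measurableType disp) (P : probability T R) (p : nat)
    (Y : {RV P >-> R}) (X : {RV P >-> 'cV[R]_p})
    (X_L2 : ('E_P[fun w => (enorm (X w) ^+ 2)%R] < +oo)%E)
    (Sigma_inv : covmx P X \in unitmx)
    (X_density : exists f, is_density X f)
    (X_support : lebesgue_Rn R p (boundary (law_support X)) = 0%E) :
  let Z := standardized P X in
  forall (Ec : {vspace 'cV[R]_p}), is_central_subspace P Y Z Ec ->
  let d : nat := \dim Ec in
  (d < p)%N ->
  let Pc := orth_proj Ec in
  let Qc := 1%:M - Pc in
  let sigPcZ := g_sigma_algebra_preimage (fun w => Pc *m Z w) in
  let sigY := g_sigma_algebra_preimage Y in
  ('E_P[fun w => (enorm (Z w) ^+ 2)%R] < +oo)%E ->
  {ae P, forall w, Qc *m cexp_cV P sigPcZ Z w = 0} ->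
  (exists lam : {RV P >-> R},
     {ae P, forall w, cvar_cV P sigPcZ Z w = lam w *: Qc}) ->
  (forall eta : 'cV[R]_p, eta \in Ec -> enorm eta = 1 ->
     (P [set w | (cexp P sigY (fun w' => dotv eta (Z w') ^+ 2) w
         = cexp P sigY (fun w' => enorm (Qc *m Z w') ^+ 2 / (p - d)%:R) w)%R]
      < 1)%E) ->
  forall Psi : set (R -> R), countable Psi ->
  total_in_L1 (regression Y (fun w => enorm (Z w) ^+ 2)) (distribution P Y) Psi ->
  exists2 psi, lin_span Psi psi & psi_space P Y Z Ec psi = Ec.
Proof.
move=> Z Ec [DRS _ _] d dp Pc Qc sigPcZ sigY Z2 lin [lam diag] nondeg Psi _ tot.
have mZ : measurable_fun setT Z by exact: measurable_standardized.
(* Z and its projection are bundled as random variables, so that the sigma-algebras they generate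
   are those of measurable functions. *)
pose Zrv : {RV P >-> 'cV[R]_p} :=
  HB.pack Z (isMeasurableFun.Build _ _ _ _ Z mZ).
have mS : measurable_fun setT (fun w => Pc *m Z w).
  exact: (measurableT_comp (measurable_mulmx_cV Pc)).
pose Srv : {RV P >-> 'cV[R]_p} :=
  HB.pack (fun w => Pc *m Z w) (isMeasurableFun.Build _ _ _ _ _ mS).
exact: (@exists_psi_space _ _ _ _ _ Y Zrv Ec Srv Psi lam).
Qed.
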